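(* Let $(W,S)$ be a Coxeter system, let $I,J\subset S$ be finitary, and let $p$ be a core $(I,J)$-coset. Then any two atomic reduced expressions of $p$ are related by a composition of atomic braid relations (associated to triples $(M,s,t)$ for various finitary subsets $M\subset S$ and $s,t\in M$ with $t\neq w_Msw_M$).
   Context: For $I\subset S$, $W_I$ is the subgroup generated by $I$; $I$ is finitary if $W_I$ is finite, and then $w_I$ is the longest element of $W_I$. Write $Is=I\sqcup\{s\}$, $I\setminus s=I\setminus\{s\}$. Cosets. For finitary $I,J$, an $(I,J)$-coset is an element $p\in W_I\backslash W/W_J$ (the pair $(I,J)$ is part of the data). It has a unique Bruhat-maximal element $\overline p$ and a unique Bruhat-minimal element $\underline p$. It is core if $I=\underline pJ\underline p^{-1}$. Composition. Let $*$ be the Coxeter monoid product on $W$: the associative product with $w*s=ws$ if $\ell(ws)>\ell(w)$ and $w*s=w$ otherwise ($s\in S$). For an $(I,J)$-coset $p$ and a $(J,K)$-coset $q$ set $p*q=W_I(\overline p*\overline q)W_K$; this composition is reduced if $\ell(\overline pw_J^{-1}\overline q)=\ell(\overline pw_J^{-1})+\ell(\overline q)$. Expressions. An expression is a sequence $[I_0,\dots,I_m]$ of finitary subsets in which consecutive subsets differ by adding or removing one element; it is also written $[I_0\pm s_1\pm\cdots\pm s_m]$, recording the added ($+$) or removed ($-$) elements in order. Its width is $m$. It expresses the $(I_0,I_m)$-coset $(W_{I_0}eW_{I_1})*\cdots*(W_{I_{m-1}}eW_{I_m})$ (and $[I]$ expresses $W_I$ as an $(I,I)$-coset). It is reduced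 if for each $1\le i\le m-1$ the composition of the coset expressed by $[I_0,\dots,I_i]$ with $W_{I_i}eW_{I_{i+1}}$ is reduced. Atoms. An atom (atomic coset) is a core coset having a reduced expression of the form $[I+s-t]$ (equivalently, a coset expressed by $[I+s-t]$ with $Is$ finitary, $s\notin I$, $t=w_{Is}sw_{Is}$). An atomic expression is an expression $[L_0+s_1-t_1+\cdots+s_m-t_m]=[L_0,P_0,L_1,P_1,\dots,P_{m-1},L_m]$ such that each $[L_i,P_i,L_{i+1}]=[L_i+s_{i+1}-t_{i+1}]$ expresses an atom. An atomic reduced expression is an atomic expression that is reduced. Atomic braid relations. Let $M\subset S$ be finitary and $s,t\in M$ with $t\ne w_Msw_M$. Write $\bar x=w_Mxw_M$ for $x\in M$. The rotation sequence $(u_i)_{i\in\mathbb Z}$ of $(M,s,t)$ is defined by $u_0=s$, $u_{-1}=\bar t$, $u_{i+1}=w_{M\setminus u_i}u_{i-1}w_{M\setminus u_i}$. Put $K=M\setminus\{s,\bar t\}$ and let $d=d(M,s,t)$ be the maximal $k\ge0$ such that the expression $[K+u_{-1}-u_1+u_0-u_2+u_1-u_3+\cdots+u_{k-1}-u_{k+1}]$ (steps $+u_{i-1}-u_{i+1}$ for $i=0,\dots,k$) is reduced. The atomic braid relation associated to $(M,s,t)$ is $$[K+u_{-1}-u_1+u_0-u_2+\cdots+u_{d-1}-u_{d+1}]\ \leftrightharpoons\ [K+\bar u_{d+1}-\bar u_{d-1}+\bar u_d-\bar u_{d-2}+\cdots+\bar u_1-\bar u_{-1}],$$ where on the right the steps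 are $+\bar u_{i+1}-\bar u_{i-1}$ for $i=d,d-1,\dots,0$. Applying it to an expression means replacing a consecutive subexpression equal to one side by the other side. *)

(* Defs.v *)
From Stdlib Require Import Relation_Operators.
From HB Require Import structures.
From mathcomp Require Import all_boot.
From mathcomp Require Import boolp classical_sets cardinality.

Set Implicit Arguments.
Unset Strict Implicit.
Unset Printing Implicit Defensive.

Local Open Scope classical_set_scope.
Local Open Scope group_scope.

(* A Coxeter group W may be infinite, and so may its set S of simple          *)
(* reflections; subsets of S are represented as sets of elements of W.        *)

Definition subgroup {W : groupType} (A : set W) : Prop :=
  [/\ A 1, forall x y, A x -> A y -> A (x * y) & forall x, A x -> A x^-1].

(* W_I, the subgroup generated by I *)
Definition parabolic {W : groupType} (I : set W) : set W := smallest subgroup I.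

(* The last clause is the universal property of the presentation with         *)
(* generators S and relations (st)^m(s,t) = 1, where m(s,t) is the order of   *)
(* st in W, for the pairs with m(s,t) finite.  The n with (st)^n = 1 are the  *)
(* multiples of m(s,t) (only 0 when st has infinite order).                   *)
Definition coxeter_system {W : groupType} (S : set W) : Prop :=
  [/\ parabolic S = setT,
      forall s, S s -> s <> 1 /\ s * s = 1
    & forall (G : groupType) (f : W -> G),
        (forall s t n, S s -> S t -> (s * t) ^+ n = 1 ->
           (f s * f t) ^+ n = 1) ->
        exists phi : W -> G,
          {morph phi : x y / x * y >-> x * y} /\
          forall s, S s -> phi s = f s].

Definition finitary {W : groupType} (S I : set W) : Prop :=
  I `<=` S /\ finite_set (parabolic I).

Definition has_word {W : groupType} (S : set W) (w : W) (n : nat) : Prop :=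
  exists l : seq W,
    [/\ size l = n, forall s, s \in l -> S s & w = \prod_(s <- l) s].

(* The values 0, 1, mulg given to [xget] here and below are never taken when  *)
(* (W, S) is a Coxeter system and the arguments are as intended.              *)
Definition ell {W : groupType} (S : set W) (w : W) : nat :=
  xget 0%N [set n | has_word S w n /\ forall k, has_word S w k -> (n <= k)%N].

Definition longest {W : groupType} (S I : set W) : W :=
  xget 1 [set w | parabolic I w /\
                  forall v, parabolic I v -> (ell S v <= ell S w)%N].

Definition reflection {W : groupType} (S : set W) : set W :=
  [set t | exists w s, S s /\ t = w * s * w^-1].

Definition bruhat {W : groupType} (S : set W) : W -> W -> Prop :=
  clos_refl_trans W (fun u v =>
    (exists2 t, reflection S t & v = u * t) /\ (ell S u < ell S v)%N).

(* the Bruhat-maximal and Bruhat-minimal elements of a double coset *)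
Definition top {W : groupType} (S p : set W) : W :=
  xget 1 [set x | p x /\ forall y, p y -> bruhat S x y -> y = x].

Definition bottom {W : groupType} (S p : set W) : W :=
  xget 1 [set x | p x /\ forall y, p y -> bruhat S y x -> y = x].

Definition coxeter_product {W : groupType} (S : set W)
    (star : W -> W -> W) : Prop :=
  [/\ associative star, left_id 1 star, right_id 1 star
    & forall w s, S s ->
        star w s = if (ell S w < ell S (w * s))%N then w * s else w].

Definition cstar {W : groupType} (S : set W) : W -> W -> W :=
  xget (fun x y => x * y) [set star | coxeter_product S star].

(* A double coset is represented by its underlying set; the pair (I,J) is     *)
(* passed along as separate arguments.                                        *)

Definition dcoset {W : groupType} (I J : set W) (x : W) : set W :=
  [set w | exists a b, [/\ parabolic I a, parabolic J b & w = a * x * b]].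

Definition is_dcoset {W : groupType} (I J p : set W) : Prop :=
  exists x, p = dcoset I J x.

Definition core {W : groupType} (S I J p : set W) : Prop :=
  is_dcoset I J p /\
  I = [set bottom S p * j * (bottom S p)^-1 | j in J].

(* composition of an (I,J)-coset p with a (J,K)-coset q *)
Definition compose {W : groupType} (S I K p q : set W) : set W :=
  dcoset I K (cstar S (top S p) (top S q)).

Definition reduced_compose {W : groupType} (S J p q : set W) : Prop :=
  let x := top S p * (longest S J)^-1 in
  ell S (x * top S q) = (ell S x + ell S (top S q))%N.

Definition adjacent {W : groupType} (I J : set W) : Prop :=
  exists s, (~ I s /\ J = s |` I) \/ (I s /\ J = I `\ s).

(* [:: I_0; ...; I_m] is the expression [I_0, ..., I_m], of width m *)
Definition expression {W : groupType} (S : set W) (e : seq (set W)) : Prop :=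
  [/\ (0 < size e)%N,
      forall i, (i < size e)%N -> finitary S (nth set0 e i)
    & forall i, (i.+1 < size e)%N ->
        adjacent (nth set0 e i) (nth set0 e i.+1)].

(* ((p * W_J e W_K1) * W_K1 e W_K2) * ... for an (I,J)-coset p and            *)
(* l = [:: K1; K2; ...]                                                       *)
Fixpoint compose_along {W : groupType} (S I J p : set W)
    (l : seq (set W)) : set W :=
  if l is K :: l' then
    compose_along S I K (compose S I K p (dcoset J K 1)) l'
  else p.

(* the (I_0,I_m)-coset expressed by [I_0, ..., I_m] *)
Definition expressed {W : groupType} (S : set W) (e : seq (set W)) : set W :=
  match e with
  | [::] => set0
  | [:: I0] => parabolic I0
  | [:: I0, I1 & l] => compose_along S I0 I1 (dcoset I0 I1 1) l
  end.

Definition expresses {W : groupType} (S : set W) (e : seq (set W))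
    (I J p : set W) : Prop :=
  [/\ expression S e, head set0 e = I, last set0 e = J & expressed S e = p].

Definition reduced {W : groupType} (S : set W) (e : seq (set W)) : Prop :=
  expression S e /\
  forall i, (0 < i)%N -> (i.+1 < size e)%N ->
    reduced_compose S (nth set0 e i) (expressed S (take i.+1 e))
      (dcoset (nth set0 e i) (nth set0 e i.+1) 1).

(* the expression [K + a_1 - b_1 + a_2 - b_2 ...] for                         *)
(* ab = [:: (a_1, b_1); (a_2, b_2); ...]                                      *)
Fixpoint addrem_tail {W : groupType} (K : set W) (ab : seq (W * W)) :
    seq (set W) :=
  if ab is (a, b) :: ab' then
    [:: a |` K, (a |` K) `\ b & addrem_tail ((a |` K) `\ b) ab']
  else [::].

Definition addrem {W : groupType} (K : set W) (ab : seq (W * W)) :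
    seq (set W) :=
  K :: addrem_tail K ab.

Definition is_atom {W : groupType} (S I J p : set W) : Prop :=
  core S I J p /\
  exists s t, reduced S (addrem I [:: (s, t)]) /\
              expresses S (addrem I [:: (s, t)]) I J p.

Definition atom_step {W : groupType} (S L P L' : set W) : Prop :=
  exists s t, [/\ [:: L; P; L'] = addrem L [:: (s, t)],
                  expression S [:: L; P; L']
                & is_atom S L L' (expressed S [:: L; P; L'])].

Fixpoint atomic_from {W : groupType} (S L : set W) (l : seq (set W)) : Prop :=
  match l with
  | [::] => True
  | [:: _] => False
  | [:: P, L' & l'] => atom_step S L P L' /\ atomic_from S L' l'
  end.

Definition atomic {W : groupType} (S : set W) (e : seq (set W)) : Prop :=
  expression S e /\ if e is L :: l then atomic_from S L l else False.

Definition bar {W : groupType} (S M : set W) (x : W) : W :=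
  longest S M * x * longest S M.

(* [rotation_pair S M s t n] is (u_{n-1}, u_n), where u is the rotation       *)
(* sequence of (M,s,t).                                                       *)
Fixpoint rotation_pair {W : groupType} (S M : set W) (s t : W) (n : nat) :
    W * W :=
  if n is n'.+1 then
    let: (a, b) := rotation_pair S M s t n' in
    (b, longest S (M `\ b) * a * longest S (M `\ b))
  else (bar S M t, s).

(* Pitfall: the index is shifted by one, [rotation S M s t n] is u_{n-1}, so  *)
(* that [rotation S M s t 0] is u_{-1}.  Indices below -1 do not occur in     *)
(* the braid relations.                                                       *)
Definition rotation {W : groupType} (S M : set W) (s t : W) (n : nat) : W :=
  (rotation_pair S M s t n).1.

Definition braid_base {W : groupType} (S M : set W) (s t : W) : set W :=
  M `\` [set s; bar S M t].

(* [K + u_{-1} - u_1 + u_0 - u_2 + ... + u_{k-1} - u_{k+1}] *)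
Definition braid_lhs {W : groupType} (S M : set W) (s t : W) (k : nat) :
    seq (set W) :=
  addrem (braid_base S M s t)
    [seq (rotation S M s t i, rotation S M s t i.+2) | i <- iota 0 k.+1].

(* [K + ubar_{k+1} - ubar_{k-1} + ... + ubar_1 - ubar_{-1}] *)
Definition braid_rhs {W : groupType} (S M : set W) (s t : W) (k : nat) :
    seq (set W) :=
  addrem (braid_base S M s t)
    [seq (bar S M (rotation S M s t i.+2), bar S M (rotation S M s t i))
       | i <- rev (iota 0 k.+1)].

Definition braid_depth {W : groupType} (S M : set W) (s t : W) (d : nat) :
    Prop :=
  reduced S (braid_lhs S M s t d) /\
  forall k, reduced S (braid_lhs S M s t k) -> (k <= d)%N.

(* the atomic braid relation associated to some (M,s,t), read left to right *)
Definition atomic_braid {W : groupType} (S : set W) (l r : seq (set W)) :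
    Prop :=
  exists M s t d,
    [/\ [/\ finitary S M, M s, M t & t <> bar S M s],
        braid_depth S M s t d,
        l = braid_lhs S M s t d
      & r = braid_rhs S M s t d].

Definition braid_step {W : groupType} (S : set W) (e e' : seq (set W)) : Prop :=
  exists a b l r,
    [/\ atomic_braid S l r \/ atomic_braid S r l,
        e = a ++ l ++ b
      & e' = a ++ r ++ b].

Definition braid_related {W : groupType} (S : set W) :
    seq (set W) -> seq (set W) -> Prop :=
  clos_refl_trans (seq (set W)) (braid_step S).

(* Main.v *)
(* An atomic reduced expression starting at I amounts to the list of the      *)

(* An atom that adds a to I has minimal element w_I w_{Ia}, which conjugates I to the next subset,
   so the element it removes is forced ([atom_step_next]) and an atomic expression is encoded by the
   list of elements it adds. It is reduced exactly when the lengths of its atoms add up in their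
   product x ([reduced_atomic]). Since the maximal element of the coset is then x w_J, all reduced
   atomic expressions of p have the same x ([atomic_reduced_tight]). What remains is a Matsumoto
   theorem for factorizations of x into atoms ([tight_related]).

   Its induction needs two facts. If a and a' are left descents of x outside I, a longest element
   splits off: x = w_I w_M y ([core_factor]), and y is again a product of atoms ([exists_tight]). In
   rank two, both sides of the braid relation have product w_I w_M ([elem_braid_lhs],
   [elem_braid_rhs]), and they begin with different atoms ([corotation_depth]); [exists_braid]
   combines these.

   The maximal element of W_I x W_J is computed in the Coxeter monoid as [w_I ** x ** w_J]
   ([top_dcoset]). The monoid product and all length arguments rest on the exchange condition
   ([exchange_word]), which is derived from the universal property of the presentation. *)
(* elements it adds, and the coset p it expresses has maximal element x w_J,  *)
(* where x = a_1 ... a_m is the length-additive product of its atoms          *)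
(* a_i = w_L w_{Ls}.  Such an x is left I-minimal and x^-1 I x = J.           *)
(*   The proof is the classical induction of Matsumoto's theorem, on l(x).    *)
(* If two expressions of x add first a and a' <> a, then w_I x has all of     *)
(* M = I + a + a' as left descents, so that W_M is finite and                 *)
(* x = w_I w_M y with lengths adding.  Both sides of the braid relation for   *)
(* (M, a', bar a) express w_I w_M; one side adds a first, the other adds a'.  *)
(* Hence x has expressions (left side)(expression of y) and                   *)
(* (right side)(expression of y), which are one braid move apart, and the     *)
(* induction hypothesis applies to the two pairs with a common first atom.    *)
From HB Require Import structures.
Require Import Defs.
From mathcomp Require Import all_boot.
From mathcomp Require Import boolp classical_sets cardinality.
From mathcomp Require Import zify_ssreflect.

Set Implicit Arguments.
Unset Strict Implicit.
Unset Printing Implicit Defensive.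

Local Open Scope classical_set_scope.
Local Open Scope group_scope.

(** * The exchange condition *)

(* The semidirect product of W with the functions W -> Z/2.  The universal
   property lifts W to it; the first component of the lift of w then counts,
   modulo 2, how often each reflection occurs among the prefix reflections
   s_1 ... s_i ... s_1 of a word for w. *)
Definition reflection_cocycle (W : groupType) : Type := ((W -> bool) * W)%type.

Section ReflectionCocycle.

Variable W : groupType.
Local Notation G := (reflection_cocycle W).

HB.instance Definition _ := gen_eqMixin G.
HB.instance Definition _ := gen_choiceMixin G.

Definition rc_mul (x y : G) : G :=
  (fun t => x.1 t (+) y.1 (t ^ x.2), x.2 * y.2).
Definition rc_one : G := (fun=> false, 1).
Definition rc_inv (x : G) : G := (fun t => x.1 (t ^ x.2^-1), x.2^-1).

Lemma rc_mulA : associative rc_mul.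
Proof.
move=> [f x] [g y] [h z]; rewrite /rc_mul /= mulgA; congr pair.
by apply: funext => t; rewrite conjgM addbA.
Qed.

Lemma rc_mul1 : left_id rc_one rc_mul.
Proof.
move=> [f x]; rewrite /rc_mul /= mul1g; congr pair.
by apply: funext => t; rewrite conjg1.
Qed.

Lemma rc_mulr1 : right_id rc_one rc_mul.
Proof.
move=> [f x]; rewrite /rc_mul /= mulg1; congr pair.
by apply: funext => t; rewrite addbF.
Qed.

Lemma rc_mulV : left_inverse rc_one rc_inv rc_mul.
Proof.
move=> [f x]; rewrite /rc_mul /= mulVg; congr pair.
by apply: funext => t; rewrite addbb.
Qed.

Lemma rc_mulrV : right_inverse rc_one rc_inv rc_mul.
Proof.
move=> [f x]; rewrite /rc_mul /= mulgV; congr pair.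
by apply: funext => t; rewrite conjgK addbb.
Qed.

HB.instance Definition _ :=
  isGroup.Build G rc_mulA rc_mul1 rc_mulr1 rc_mulV rc_mulrV.

Definition rc_gen (s : W) : G := (eq_op^~ s, s).

(** The prefix reflections of the word s t s t ... of length 2n are the (st)^j s with 0 <= j <
    2n. *)
Lemma rc_gen_expg (s t : W) (n : nat) : s * s = 1 -> t * t = 1 ->
  (rc_gen s * rc_gen t) ^+ n =
  (fun r => \big[addb/false]_(0 <= j < n.*2) (r == (s * t) ^+ j * s),
   (s * t) ^+ n).
Proof.
move=> ss tt; have sV : s^-1 = s by apply: mulg1_eq.
have tV : t^-1 = t by apply: mulg1_eq.
have sc m : s * (s * t) ^- m = (s * t) ^+ m * s.
  rewrite -expVgn invgM sV tV; elim: m => [|m IH].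
    by rewrite !expg0 mulg1 mul1g.
  by rewrite expgSr mulgA IH expgSr !mulgA.
elim: n => [|n IH] /=.
  by rewrite !expg0; congr pair; apply: funext => r; rewrite big_geq.
rewrite !expgSr IH; congr pair; apply: funext => r /=.
rewrite doubleS !big_nat_recr //= -addbA; congr (_ (+) (_ (+) _)).
  rewrite -(inj_eq (@conjg_inj _ ((s * t) ^- n))) conjgK; congr (_ == _).
  by rewrite conjgE invgK sc mulgA -expgnDr addnn.
rewrite -(inj_eq (@conjg_inj _ s^-1)) conjgK.
rewrite -(inj_eq (@conjg_inj _ ((s * t) ^- n))) conjgK; congr (_ == _).
rewrite !conjgE !invgK sV -addnn -addnS expgnDr -!mulgA sc !mulgA.
by rewrite expgS !mulgA.
Qed.
End ReflectionCocycle.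

(** * Words, length and exchange in parabolic subgroups *)

Section Coxeter.

Variables (W : groupType) (S : set W).
Hypothesis hS : coxeter_system S.
Implicit Types (s t w x y z : W) (l : seq W) (A I J K L M P : set W).

Local Notation len := (ell S).
Local Notation wprod l := (\prod_(s <- l) s).

(* Unlike [mulgA], rewriting with this keeps the product of [W] in a form on
   which [lia] recognizes equal terms. *)
Lemma mulA x y z : x * (y * z) = x * y * z. Proof. exact: mulgA. Qed.

Definition letters_in A l := forall s, s \in l -> A s.

Lemma letters_in_cons A s l : letters_in A (s :: l) <-> A s /\ letters_in A l.
Proof.
split=> [h|[hs hl] t]; last by rewrite inE => /orP[/eqP ->|/hl].
by split=> [|t tl]; apply: h; rewrite inE ?eqxx ?tl ?orbT.
Qed.

Lemma letters_in_cat A l l' :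
  letters_in A (l ++ l') <-> letters_in A l /\ letters_in A l'.
Proof.
split=> [h|[hl hl'] t]; last by rewrite mem_cat => /orP[/hl|/hl'].
by split=> t tl; apply: h; rewrite mem_cat tl ?orbT.
Qed.

Lemma simple2 s : S s -> s * s = 1. Proof. by case: hS => _ h _ /h[]. Qed.
Lemma simple_neq1 s : S s -> s <> 1. Proof. by case: hS => _ h _ /h[]. Qed.
Lemma simpleV s : S s -> s^-1 = s. Proof. by move/simple2/mulg1_eq. Qed.
Lemma mulKs s w : S s -> s * (s * w) = w.
Proof. by move=> /simple2 h; rewrite mulA h mul1g. Qed.
Lemma mulsK s w : S s -> w * s * s = w.
Proof. by move=> /simple2 h; rewrite -mulA h mulg1. Qed.

Lemma parabolic_subgroup A : subgroup (parabolic A).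
Proof.
split=> [B [[]] //|x y hx hy B hB|x hx B hB]; have [[h1 hM hV] _] := hB.
  exact: hM (hx _ hB) (hy _ hB).
exact: hV (hx _ hB).
Qed.

Lemma parabolic_gen A s : A s -> parabolic A s.
Proof. by move=> As B [_]; apply. Qed.

Lemma parabolic1 A : parabolic A 1. Proof. by case: (parabolic_subgroup A). Qed.

Lemma parabolicM A x y : parabolic A x -> parabolic A y -> parabolic A (x * y).
Proof. by case: (parabolic_subgroup A) => _ h _; apply: h. Qed.

Lemma parabolicV A x : parabolic A x -> parabolic A x^-1.
Proof. by case: (parabolic_subgroup A) => _ _ h; apply: h. Qed.

Lemma sub_parabolic A B x : A `<=` B -> parabolic A x -> parabolic B x.
Proof.
move=> AB; apply; split; first exact: parabolic_subgroup.
by move=> s /AB /parabolic_gen.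
Qed.

Lemma parabolic_wprod A l : letters_in A l -> parabolic A (wprod l).
Proof.
elim: l => [|s l IH]; first by rewrite big_nil => _; exact: parabolic1.
move=> /letters_in_cons[As /IH h]; rewrite big_cons.
by apply: parabolicM => //; apply: parabolic_gen.
Qed.

Lemma prod_rev_inv l : letters_in S l -> (wprod l)^-1 = wprod (rev l).
Proof.
elim: l => [|s l IH]; first by rewrite !big_nil invg1.
move=> /letters_in_cons[Ss /IH h].
by rewrite rev_cons -cats1 big_cat big_seq1 /= big_cons invgM h simpleV.
Qed.

Lemma letters_in_rev A l : letters_in A l -> letters_in A (rev l).
Proof. by move=> h s; rewrite mem_rev; apply: h. Qed.

Lemma parabolic_word A x : A `<=` S -> parabolic A x ->
  exists2 l, letters_in A l & x = wprod l.
Proof.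
move=> AS hx; apply: (hx [set y | exists2 l, letters_in A l & y = wprod l]).
split; last first.
  move=> s As; exists [:: s]; last by rewrite big_seq1.
  by move=> t; rewrite inE => /eqP ->.
split=> [|_ _ [l hl ->] [l' hl' ->]|_ [l hl ->]].
- by exists [::]; rewrite ?big_nil.
- by exists (l ++ l'); rewrite ?big_cat //; apply/letters_in_cat.
exists (rev l); first exact: letters_in_rev.
by apply: prod_rev_inv => s /hl /AS.
Qed.

Lemma word_exists w : exists2 l, letters_in S l & w = wprod l.
Proof.
apply: parabolic_word => //.
by case: hS => -> _ _.
Qed.

Lemma ellP w : has_word S w (len w) /\
  forall k, has_word S w k -> (len w <= k)%N.
Proof.
have ex : exists n, `[< has_word S w n >].
  by have [l hl ->] := word_exists w; exists (size l); apply/asboolP; exists l.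
apply: (@xgetPex _ 0%N
  [set n | has_word S w n /\ forall k, has_word S w k -> (n <= k)%N]).
case: (ex_minnP ex) => n /asboolP hn hmin; exists n; split=> // k hk.
by apply: hmin; apply/asboolP.
Qed.

Lemma reduced_word w :
  exists l, [/\ letters_in S l, w = wprod l & size l = len w].
Proof. by have [[l [h1 h2 h3]] _] := ellP w; exists l. Qed.

Lemma ell_wprod l : letters_in S l -> (len (wprod l) <= size l)%N.
Proof. by move=> hl; have [_] := ellP (wprod l); apply; exists l. Qed.

Lemma ell1 : len 1 = 0%N.
Proof.
by apply/eqP; rewrite -leqn0; have := @ell_wprod [::]; rewrite big_nil; apply.
Qed.

Lemma ell_eq0 w : len w = 0%N -> w = 1.
Proof.
have [l [_ -> <-]] := reduced_word w.
by case: l => //; rewrite big_nil.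
Qed.

Lemma ellV w : len w^-1 = len w.
Proof.
have le x : (len x^-1 <= len x)%N.
  have [l [hl -> <-]] := reduced_word x; rewrite prod_rev_inv // -(size_rev l).
  by apply: ell_wprod; apply: letters_in_rev.
by apply/eqP; rewrite eqn_leq le -{1}(invgK w) le.
Qed.

Lemma ellM x y : (len (x * y) <= len x + len y)%N.
Proof.
have [l [hl -> <-]] := reduced_word x; have [l' [hl' -> <-]] := reduced_word y.
by rewrite -size_cat -big_cat; apply: ell_wprod; apply/letters_in_cat.
Qed.

(** [N w t] is the parity of the number of occurrences of t among the prefix reflections of any word
    for w. The universal property applies because (st)^n = 1 makes (st)^j s periodic in j with
    period n, so that the 2n prefix reflections cancel in pairs. *)
Lemma reflection_parity : exists N : W -> W -> bool,
  [/\ N 1 = fun=> false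
    & forall s w, S s -> N (s * w) = fun t => (t == s) (+) N w (t ^ s)].
Proof.
case: hS => _ _ /(_ (reflection_cocycle W) (@rc_gen W)) [].
  move=> s t n Ss St st1.
  rewrite rc_gen_expg; try exact: simple2.
  rewrite st1; congr pair; apply: funext => r.
  rewrite -addnn (big_cat_nat _ (n := n)) ?leq_addr //=.
  rewrite -{2}[n]add0n big_addn addnK.
  under [X in _ (+) X]eq_bigr => j _ do rewrite expgnDr st1 mulg1.
  by rewrite addbb.
move=> phi [phiM phiS]; exists (fun w => (phi w).1); split.
  have : phi 1 = 1 by apply: (@mulgI _ (phi 1)); rewrite -phiM !mulg1.
  by move=> ->.
by move=> s w Ss; rewrite phiM phiS.
Qed.

Lemma wprod_cons s l : wprod (s :: l) = s * wprod l.
Proof. by rewrite big_cons. Qed.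

Lemma wprod_cat l l' : wprod (l ++ l') = wprod l * wprod l'.
Proof. by rewrite big_cat. Qed.

Definition delete (i : nat) l := take i l ++ drop i.+1 l.

Lemma letters_in_delete A i l : letters_in A l -> letters_in A (delete i l).
Proof.
move=> h; apply/letters_in_cat.
by split=> s hs; apply: h; [apply: mem_take hs|apply: mem_drop hs].
Qed.

Lemma size_delete i l : (i < size l)%N -> (size (delete i l)).+1 = size l.
Proof.
move=> lt; rewrite size_cat size_drop size_takel ?(ltnW lt) // -addnS.
by rewrite subnSK // subnKC // ltnW.
Qed.

Lemma delete_cat i l l' : delete i (l ++ l') =
  if (i < size l)%N then delete i l ++ l' else l ++ delete (i - size l) l'.
Proof.
rewrite /delete take_cat drop_cat; case: ltnP => h; last first.
  by rewrite ltnNge (leq_trans h (leqnSn _)) /= subSn // catA.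
rewrite -catA; congr (_ ++ _); case: ltnP => // h'.
have e : i.+1 = size l by apply/eqP; rewrite eqn_leq h h'.
by rewrite e subnn drop0 drop_size.
Qed.

(** If [N w s] is odd, s is a prefix reflection of the word, and multiplying by it deletes a letter.
    If it is even, it is odd for sw, and deleting a letter from a reduced word of sw makes w shorter
    than sw, against the hypothesis. *)
Lemma exchange_word s l : S s -> letters_in S l ->
  (len (s * wprod l) <= len (wprod l))%N ->
  exists2 i, (i < size l)%N & s * wprod l = wprod (delete i l).
Proof.
have [N [N1 NM]] := reflection_parity.
have del t l' : letters_in S l' -> N (wprod l') t ->
    exists2 i, (i < size l')%N & t * wprod l' = wprod (delete i l').
  elim: l' t => [|a l' IH] t; first by rewrite big_nil N1.
  move=> /letters_in_cons[Sa Sl']; rewrite wprod_cons NM //.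
  case: eqVneq => [-> _|_ /= /IH[]// i lt e].
    by exists 0%N; rewrite // mulKs // /delete /= drop0.
  exists i.+1 => //; rewrite -[delete _ _]/(a :: delete i l') wprod_cons -e.
  by rewrite conjgE !mulA mulgV mul1g.
have Ns w : S s -> N (s * w) s = ~~ N w s.
  by move=> Ss; rewrite NM // eqxx conjgE mulKg.
move=> Ss Sl le; apply: (del) => //.
apply: contraTT isT => /negPf nN; exfalso.
have [l' [Sl' e sz]] := reduced_word (s * wprod l).
have := Ns (wprod l) Ss; rewrite nN e => /(del _ _ Sl')[i lt].
rewrite -e mulKs // => ew.
have := ell_wprod (letters_in_delete (i := i) Sl').
by rewrite -ew => /(leq_trans le); rewrite -sz -(size_delete lt) ltnn.
Qed.

Lemma ell_simple_le s w : S s -> (len (s * w) <= (len w).+1)%N.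
Proof.
move=> Ss; have [l [Sl -> <-]] := reduced_word w.
rewrite -wprod_cons -[(size l).+1]/(size (s :: l)); apply: ell_wprod.
exact/letters_in_cons.
Qed.

Lemma ell_simple s w : S s ->
  len (s * w) = (len w).+1 \/ len w = (len (s * w)).+1.
Proof.
move=> Ss; have le1 := ell_simple_le w Ss.
have le2 := ell_simple_le (s * w) Ss; rewrite mulKs // in le2.
have [le|lt] := leqP (len (s * w)) (len w); last first.
  by left; apply/eqP; rewrite eqn_leq le1.
right; apply/eqP; rewrite eqn_leq le2 /=.
have [l [Sl ew sz]] := reduced_word w; rewrite ew in le *.
have [i lt ->] := exchange_word Ss Sl le.
rewrite -ew -sz -(size_delete lt) ltnS.
by apply: ell_wprod; apply: letters_in_delete.
Qed.

Lemma exchange s x y : S s -> (len (s * (x * y)) < len (x * y))%N ->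
  (len (s * x) < len x)%N \/
  exists2 y', (len y' < len y)%N & s * (x * y) = x * y'.
Proof.
move=> Ss lt; have [l [Sl ex szx]] := reduced_word x.
have [l' [Sl' ey szy]] := reduced_word y.
have Sll : letters_in S (l ++ l') by apply/letters_in_cat.
have exy : x * y = wprod (l ++ l') by rewrite wprod_cat ex ey.
have [|i] := exchange_word Ss Sll; first by rewrite -exy ltnW.
rewrite -exy delete_cat; case: ifPn => [lti _|gei lti].
  rewrite wprod_cat -ey mulA => /mulIg e; left; rewrite e -szx.
  by rewrite -(size_delete lti) ltnS ell_wprod //; apply: letters_in_delete.
rewrite wprod_cat -ex => e; right.
exists (wprod (delete (i - size l) l')) => //.
rewrite -szy -(@size_delete (i - size l) l').
  by rewrite ltnS ell_wprod //; apply: letters_in_delete.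
by rewrite -(ltn_add2l (size l)) -size_cat subnKC // leqNgt.
Qed.

Lemma ell_simpleV s w : S s -> len (s * w^-1) = len (w * s).
Proof. by move=> Ss; rewrite -ellV invgM invgK simpleV. Qed.

Lemma ell_simple_r s w : S s ->
  len (w * s) = (len w).+1 \/ len w = (len (w * s)).+1.
Proof.
by move=> Ss; rewrite -(ell_simpleV w Ss) -(ellV w); apply: ell_simple.
Qed.

Lemma ell_simple_le_r s w : S s -> (len (w * s) <= (len w).+1)%N.
Proof. by move=> Ss; rewrite -(ell_simpleV w Ss) -(ellV w) ell_simple_le. Qed.

Lemma exchange_r s x y : S s -> (len (x * y * s) < len (x * y))%N ->
  (len (y * s) < len y)%N \/
  exists2 x', (len x' < len x)%N & x * y * s = x' * y.
Proof.
move=> Ss lt; have [|h|[z h e]] := @exchange s y^-1 x^-1 Ss.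
- by rewrite -!invgM ell_simpleV // ellV.
- by left; move: h; rewrite ell_simpleV // ellV.
right; exists z^-1; first by rewrite ellV -(ellV x).
by apply: invg_inj; rewrite !invgM invgK simpleV.
Qed.

(** Exchange only ever deletes letters, so shortening a word over A keeps it over A. *)
Lemma parabolic_reduced_word A w : A `<=` S -> parabolic A w ->
  exists l, [/\ letters_in A l, w = wprod l & size l = len w].
Proof.
move=> AS /(parabolic_word AS)[l Al ->]; elim: l Al => [|s l IH] Al.
  by exists [::]; split; rewrite // big_nil ell1.
move: Al => /letters_in_cons[As /IH[l' [Al' e sz]]].
rewrite wprod_cons e; rewrite e in sz.
have Sl' : letters_in S l' by move=> t /Al' /AS.
have [le|lt] := leqP (len (s * wprod l')) (len (wprod l')).
  have [i lt e'] := exchange_word (AS _ As) Sl' le.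
  exists (delete i l'); split => //; first exact: letters_in_delete.
  have [eq|eq] := ell_simple (wprod l') (AS _ As).
    by move: le; rewrite eq ltnn.
  by apply: succn_inj; rewrite size_delete // sz eq.
exists (s :: l'); split; rewrite ?wprod_cons //; first exact/letters_in_cons.
have [->|eq] := ell_simple (wprod l') (AS _ As); first by rewrite /= sz.
by move: lt; rewrite eq ltnNge leqnSn.
Qed.

Lemma parabolic_ind A (P : W -> Prop) : A `<=` S -> P 1 ->
  (forall w s, A s -> parabolic A w -> len (w * s) = (len w).+1 -> P w ->
     P (w * s)) ->
  forall w, parabolic A w -> P w.
Proof.
move=> AS P1 PM w /(parabolic_reduced_word AS)[l [+ -> +]].
elim/last_ind: l => [|l s IH]; first by rewrite big_nil.
rewrite -cats1 => /letters_in_cat[Al /letters_in_cons[As _]].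
rewrite wprod_cat big_seq1 size_cat addn1 => e.
have le : (len (wprod l) <= size l)%N by apply: ell_wprod => t /Al /AS.
have [e'|e'] := ell_simple_r (wprod l) (AS _ As); last first.
  by move: le; rewrite e' -e leqNgt => /negP[]; rewrite ltnS.
apply: PM => //; first exact: parabolic_wprod.
by apply: IH => //; apply: succn_inj; rewrite e.
Qed.

Lemma parabolic_indl A (P : W -> Prop) : A `<=` S -> P 1 ->
  (forall w s, A s -> parabolic A w -> len (s * w) = (len w).+1 -> P w ->
     P (s * w)) ->
  forall w, parabolic A w -> P w.
Proof.
move=> AS P1 PM w /parabolicV Aw; rewrite -[w]invgK.
apply: (@parabolic_ind A (fun x => P x^-1)) Aw => // [|x s As Ax e IH].
  by rewrite invg1.
have Ss := AS _ As; rewrite invgM (simpleV Ss); apply: PM => //.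
  exact: parabolicV.
by rewrite ell_simpleV // e ellV.
Qed.

Lemma parabolicS w : parabolic S w.
Proof. by case: hS => -> _ _. Qed.

(** * The Coxeter monoid *)

Lemma ell_lt_neg_l s w : S s ->
  (len (s * w) < len w)%N = ~~ (len w < len (s * w))%N.
Proof. by move=> Ss; case: (ell_simple w Ss); lia. Qed.

Lemma ell_lt_neg_r s w : S s ->
  (len (w * s) < len w)%N = ~~ (len w < len (w * s))%N.
Proof. by move=> Ss; case: (ell_simple_r w Ss); lia. Qed.

(** Exchange in s(wt) cannot delete from w, so it deletes t. *)
Lemma ell_lift_l_r s t w : S s -> S t -> (len w < len (s * w))%N ->
  (len w < len (w * t))%N -> (len (s * w * t) < len (w * t))%N ->
  s * w = w * t.
Proof.
move=> Ss St hs ht; rewrite -mulA => h.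
have [|[y hy]] := exchange Ss h; first lia.
have -> : y = 1.
  apply: ell_eq0; have : (len t <= 1)%N; last lia.
  rewrite -[t]mulg1 (leq_trans (ell_simple_le _ St)) ?ell1 //.
by rewrite mulg1 mulA => e; rewrite -[RHS](congr1 (fun z => z * t) e) mulsK.
Qed.

Local Notation Lop s w := (if (len w < len (s * w)%g)%N then (s * w)%g else w).
Local Notation Rop w s := (if (len w < len (w * s)%g)%N then (w * s)%g else w).

(** The source of associativity of the monoid product. The one delicate case is where sw and wt are
    longer than w but swt is not longer still; then sw = wt. *)
Lemma Lop_Rop s t w : S s -> S t -> Lop s (Rop w t) = Rop (Lop s w) t.
Proof.
move=> Ss St.
have := ell_simple (w * t) Ss; have := ell_simple_r (s * w) St; rewrite mulA.
have := ell_simple w Ss; have := ell_simple_r w St.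
have := @ell_lift_l_r s t w Ss St.
case: (ltnP (len w) (len (s * w))) => hs;
  case: (ltnP (len w) (len (w * t))) => ht.
all: rewrite ?mulA => lift h1 h2 h3 h4.
- case: ltnP => h5; case: ltnP => h6 //; try by exfalso; lia.
  by rewrite lift //; lia.
- by rewrite hs ltnNge; case: leqP => // h5; exfalso; lia.
- by rewrite ltnNge; case: leqP => // h5; exfalso; lia.
- by rewrite ltnNge hs.
Qed.

(* Left and right multiplications by letters commute, so the product of x and
   y can be computed along a reduced word of either factor. *)
Definition lstar l w := foldr (fun s w => Lop s w) w l.
Definition rstar w l := foldl (fun w s => Rop w s) w l.

Lemma lstar_rstar l l' w : letters_in S l -> letters_in S l' ->
  lstar l (rstar w l') = rstar (lstar l w) l'.
Proof.
move=> Sl; have comm x t : S t -> lstar l (Rop x t) = Rop (lstar l x) t.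
  move=> St; elim: l Sl => //= s l IHl /letters_in_cons[Ss Sl].
  by rewrite IHl // Lop_Rop.
elim: l' w => [//|t l' IH] w /letters_in_cons[St Sl'] /=.
by rewrite IH // comm.
Qed.

Lemma lstar_reduced l : letters_in S l -> size l = len (wprod l) ->
  lstar l 1 = wprod l.
Proof.
elim: l => [|s l IH]; first by rewrite big_nil.
move=> /letters_in_cons[Ss Sl]; rewrite wprod_cons /= => e.
have le := ell_wprod Sl; have := ell_simple_le (wprod l) Ss => le'.
have szl : size l = len (wprod l).
  by apply/eqP; rewrite eqn_leq le andbT -ltnS e.
by rewrite IH // -e -szl ltnSn.
Qed.

Lemma rstar_reduced l : letters_in S l -> size l = len (wprod l) ->
  rstar 1 l = wprod l.
Proof.
elim/last_ind: l => [|l s IH]; first by rewrite big_nil.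
rewrite -cats1 => /letters_in_cat[Sl /letters_in_cons[Ss _]].
rewrite wprod_cat big_seq1 size_cat addn1 => e.
have le := ell_wprod Sl; have := ell_simple_r (wprod l) Ss => le'.
have szl : size l = len (wprod l).
  apply/eqP; rewrite eqn_leq le andbT -ltnS e.
  by case: le' => h; rewrite h // leqW.
by rewrite /rstar foldl_cat -/(rstar 1 l) IH //= -e -szl ltnSn.
Qed.

Lemma coxeter_product_exists : exists star, coxeter_product S star.
Proof.
have [rw rwP] := choice reduced_word.
have l1 x : lstar (rw x) 1 = x.
  by have [h1 h2 h3] := rwP x; rewrite lstar_reduced -?h2.
have r1 x : rstar 1 (rw x) = x.
  by have [h1 h2 h3] := rwP x; rewrite rstar_reduced -?h2.
have Srw x : letters_in S (rw x) by case: (rwP x).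
(* The product may be evaluated along a word of either factor; this gives associativity and
   independence of the chosen words. *)
have lr x y : rstar x (rw y) = lstar (rw x) y.
  by rewrite -{1}(l1 x) -lstar_rstar // r1.
exists (fun x y => rstar x (rw y)); split.
- by move=> x y z; rewrite lr lstar_rstar // -lr.
- by move=> x; rewrite r1.
- by move=> x; rewrite lr l1.
move=> w s Ss; rewrite lr -[RHS]/(rstar w [:: s]) -{2}(l1 w).
have e : s = rstar 1 [:: s].
  rewrite /= mul1g ell1; case: ltnP => //.
  by rewrite leqn0 => /eqP /ell_eq0 /(simple_neq1 Ss).
rewrite -lstar_rstar -?e //.
by move=> t; rewrite inE => /eqP ->.
Qed.

Lemma word_ind (P : W -> Prop) : P 1 ->
  (forall w s, S s -> len (w * s) = (len w).+1 -> P w -> P (w * s)) ->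
  forall w, P w.
Proof.
move=> P1 PM w; apply: (@parabolic_ind S P) (parabolicS w) => // x s Ss _.
exact: PM.
Qed.

Lemma cstarP : coxeter_product S (cstar S).
Proof.
have [star h] := coxeter_product_exists.
exact: (@xgetPex _ _ [set star | coxeter_product S star] (ex_intro _ _ h)).
Qed.

Local Notation "x ** y" := (cstar S x y) (at level 40, left associativity).

Lemma starA x y z : x ** (y ** z) = x ** y ** z. Proof. by case: cstarP. Qed.
Lemma star1w x : 1 ** x = x. Proof. by case: cstarP. Qed.
Lemma starw1 x : x ** 1 = x. Proof. by case: cstarP. Qed.
Lemma star_simple x s : S s -> x ** s = Rop x s.
Proof. by case: cstarP => _ _ _; apply. Qed.

Lemma star_simple_lt x s : S s -> (len x < len (x * s))%N -> x ** s = x * s.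
Proof. by move=> Ss h; rewrite star_simple // h. Qed.

Lemma simple_star s x : S s -> s ** x = Lop s x.
Proof.
move=> Ss; elim/word_ind: x => [|w t St e IH].
  rewrite starw1 mulg1 ell1; case: ltnP => //.
  by rewrite leqn0 => /eqP /ell_eq0 /(simple_neq1 Ss).
have et : w ** t = w * t by rewrite star_simple_lt ?e.
by rewrite -et starA IH !star_simple // Lop_Rop.
Qed.

Lemma star_add x y : len (x * y) = (len x + len y)%N -> x ** y = x * y.
Proof.
elim/word_ind: y => [|w s Ss e IH]; first by rewrite starw1 mulg1.
rewrite e mulA => h.
have := ell_simple_r (x * w) Ss; have := ellM x w => h1 h2.
by rewrite -(@star_simple_lt w) ?e // starA IH ?star_simple_lt //; lia.
Qed.

(** When a new letter s fails to lengthen x'w, exchange must delete from x' because ws is reduced;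
    the product then ends in ws all the same. *)
Lemma star_prefix x y :
  exists2 x', x ** y = x' * y & len (x ** y) = (len x' + len y)%N.
Proof.
elim/word_ind: y => [|w s Ss e [x' e1 e2]].
  by exists x; rewrite starw1 ?mulg1 // ell1 addn0.
have -> : x ** (w * s) = x' * w ** s.
  by rewrite -e1 -starA (@star_simple_lt w) ?e.
rewrite e1 in e2; rewrite star_simple //; case: ltnP => h.
  exists x'; rewrite ?mulA //.
  by have [|] := ell_simple_r (x' * w) Ss; lia.
have [|h'|[x'' lt ex'']] := @exchange_r s x' w Ss.
- by rewrite ell_lt_neg_r // -leqNgt.
- by move: h'; rewrite e ltnNge leqnSn.
have ex : x' * w = x'' * (w * s) by rewrite mulA -ex'' mulsK.
by exists x'' => //; have := ellM x'' (w * s); rewrite -ex; lia.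
Qed.

Lemma ell_star_r x y : (len y <= len (x ** y))%N.
Proof. by have [x' _ ->] := star_prefix x y; rewrite leq_addl. Qed.

Lemma ell_star_l x y : (len x <= len (x ** y))%N.
Proof.
elim/word_ind: y => [|w s Ss e IH]; first by rewrite starw1.
rewrite -(@star_simple_lt w) ?e // starA star_simple //.
by case: ltnP => // /ltnW; apply: leq_trans.
Qed.

(** * Parabolic subgroups and their longest elements *)

Definition rmax A z := forall s, A s -> (len (z * s) < len z)%N.
Definition rmin A z := forall s, A s -> (len z < len (z * s))%N.
Definition lmax A z := forall s, A s -> (len (s * z) < len z)%N.
Definition lmin A z := forall s, A s -> (len z < len (s * z))%N.

Section Extremal.

Variable A : set W.
Hypothesis AS : A `<=` S.

Lemma rmaxV z : rmax A z^-1 <-> lmax A z.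
Proof.
split=> h s As; have := h s As; have Ss := AS As.
  by rewrite -(ell_simpleV z^-1) // invgK ellV.
by rewrite -(ell_simpleV z^-1) // invgK ellV.
Qed.

Lemma rminV z : rmin A z^-1 <-> lmin A z.
Proof.
split=> h s As; have := h s As; have Ss := AS As.
  by rewrite -(ell_simpleV z^-1) // invgK ellV.
by rewrite -(ell_simpleV z^-1) // invgK ellV.
Qed.

Lemma last_letter v : parabolic A v -> v = 1 \/
  exists w s, [/\ A s, parabolic A w, v = w * s & len v = (len w).+1].
Proof.
move: v; apply: parabolic_ind => //; first by left.
by move=> w s As Aw e _; right; exists w, s.
Qed.

Lemma rmax_star z v : rmax A z -> parabolic A v -> z ** v = z.
Proof.
move=> zA; apply: (@parabolic_ind A (fun v => z ** v = z)) => //.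
  exact: starw1.
move=> w s As _ e IH; have Ss := AS As.
rewrite -(@star_simple_lt w) ?e // starA IH star_simple //.
by rewrite ltnNge ltnW // zA.
Qed.

Lemma star_lmax z v : lmax A z -> parabolic A v -> v ** z = z.
Proof.
move=> zA; apply: (@parabolic_indl A (fun v => v ** z = z)) => //.
  exact: star1w.
move=> w s As _ e IH; have Ss := AS As.
have -> : s * w = s ** w by rewrite simple_star // e ltnSn.
by rewrite -starA IH simple_star // ltnNge ltnW // zA.
Qed.

Lemma rmax_ell z v : rmax A z -> parabolic A v ->
  len z = (len (z * v) + len v)%N.
Proof.
move=> zA Av; have [x e1 e2] := star_prefix z v^-1.
rewrite rmax_star // in e1 e2; try exact: parabolicV.
by rewrite [in LHS]e2 [in RHS]e1 mulgVK ellV.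
Qed.

Lemma lmax_ell z v : lmax A z -> parabolic A v ->
  len z = (len v + len (v * z))%N.
Proof.
move=> /rmaxV zA /parabolicV Av.
by rewrite -ellV (rmax_ell zA Av) -invgM !ellV addnC.
Qed.

(** By exchange, lengths add for a shortest element xu of the coset x W_A. If u were not 1, the last
    letter of u^-1 would be a right descent of x = (xu)u^-1. *)
Lemma rmin_add x v : rmin A x -> parabolic A v ->
  len (x * v) = (len x + len v)%N.
Proof.
have min_add m : (forall u, parabolic A u -> (len m <= len (m * u))%N) ->
    forall u, parabolic A u -> len (m * u) = (len m + len u)%N.
  move=> minm; apply: parabolic_ind => // [|w s As Aw e IH].
    by rewrite mulg1 ell1 addn0.
  have Ss := AS As; rewrite mulA e.
  have [->|h] := ell_simple_r (m * w) Ss; first by rewrite IH addnS.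
  have [|h'|[x' lt ex']] := @exchange_r s m w Ss.
  - by rewrite [ltnRHS]h.
  - by move: h'; rewrite e ltnNge leqnSn.
  have /minm : parabolic A (w * s * w^-1).
    by do !apply: parabolicM => //; [exact: parabolic_gen|exact: parabolicV].
  by rewrite leqNgt !mulA ex' mulgK lt.
have ex : exists n, `[< exists2 u, parabolic A u & len (x * u) = n >].
  exists (len x); apply/asboolP; exists 1; rewrite ?mulg1 //.
  exact: parabolic1.
case: (ex_minnP ex) => _ /asboolP[u Au <-] umin xA Av.
have minm w : parabolic A w -> (len (x * u) <= len (x * u * w))%N.
  move=> Aw; apply: umin; apply/asboolP; exists (u * w); rewrite ?mulA //.
  exact: parabolicM.
suff u1 : u = 1 by move: minm; rewrite u1 mulg1 => /min_add; apply.
have [u1|[w [s [As Aw eu ew]]]] := last_letter (parabolicV Au).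
  by rewrite -[u]invgK u1 invg1.
have := xA s As; have -> : x = x * u * (w * s) by rewrite -eu mulgK.
have Ss := AS As.
rewrite mulA mulsK // -mulA !(min_add _ minm) ?ew -?eu.
- by rewrite ltn_add2l ew ltnNge leqnSn.
- exact: Aw.
- exact: parabolicV.
Qed.

End Extremal.

Local Notation "'w_' I" := (longest S I)
  (at level 8, I at level 2, format "'w_' I").

Lemma longestP I : finitary S I -> parabolic I (w_ I) /\
  forall v, parabolic I v -> (len v <= len (w_ I))%N.
Proof.
move=> [_ /finite_seqP[r er]].
apply: (@xgetPex _ 1 [set w | parabolic I w /\
                  forall v, parabolic I v -> (len v <= len w)%N]).
have ex : exists n, `[< exists2 u, parabolic I u & len u = n >].
  by exists (len 1); apply/asboolP; exists 1 => //; apply: parabolic1.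
have le n : `[< exists2 u, parabolic I u & len u = n >] ->
    (n <= \max_(u <- r) len u)%N.
  by move=> /asboolP[u + <-]; rewrite er => ur; apply: leq_bigmax_seq.
case: (ex_maxnP ex le) => _ /asboolP[u Iu <-] umax.
by exists u; split=> // v Iv; apply: umax; apply/asboolP; exists v.
Qed.

(** By [rmax_ell], lengths in W_I are bounded by that of z, and there are only finitely many words
    of bounded length over I. *)
Lemma rmax_finitary I z : I `<=` S -> finite_set I -> rmax I z -> finitary S I.
Proof.
move=> IS finI zI; split=> //.
have fin n : finite_set [set w | exists l,
    [/\ letters_in I l, (size l <= n)%N & w = wprod l]].
  elim: n => [|n IH].
    apply: (sub_finite_set _ (finite_set1 1)) => _ [[|s l] [_ // _ ->]] /=.
    by rewrite big_nil.
  have := finite_image2 (fun s w => s * w) finI IH.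
  move=> /(conj (finite_set1 (1 : W))); rewrite -finite_setU.
  apply: sub_finite_set.
  move=> _ [[|s l] [Il sz ->]]; first by left; rewrite /= big_nil.
  move: Il => /letters_in_cons[Is Il]; right; exists s => //.
  by exists (wprod l); [exists l|rewrite wprod_cons].
apply: (sub_finite_set _ (fin (len z))) => w Iw.
have [l [Il e sz]] := parabolic_reduced_word IS Iw.
by exists l; split; rewrite // sz (rmax_ell IS zI Iw) leq_addl.
Qed.

Lemma finitary_sub I J : finitary S J -> I `<=` J -> finitary S I.
Proof.
move=> [JS fin] IJ; split; first by move=> s /IJ /JS.
by apply: (sub_finite_set _ fin) => w; apply: sub_parabolic.
Qed.

Lemma finitary_finite I : finitary S I -> finite_set I.
Proof.
by move=> [_ fin]; apply: (sub_finite_set _ fin) => w; apply: parabolic_gen.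
Qed.

Section Longest.

Variable I : set W.
Hypothesis finI : finitary S I.

Lemma finitaryS : I `<=` S. Proof. by case: finI. Qed.

Lemma longest_in : parabolic I (w_ I).
Proof. by case: (longestP finI). Qed.

Lemma longest_rmax : rmax I (w_ I).
Proof.
move=> s Is; have Ss := finitaryS Is.
rewrite ell_lt_neg_r // -leqNgt; have [h] := longestP finI; apply.
by apply: parabolicM => //; apply: parabolic_gen.
Qed.

Lemma longest_lmax : lmax I (w_ I).
Proof.
move=> s Is; have Ss := finitaryS Is.
rewrite ell_lt_neg_l // -leqNgt; have [h] := longestP finI; apply.
by apply: parabolicM => //; apply: parabolic_gen.
Qed.

Lemma rmax_longest z : parabolic I z -> rmax I z -> z = w_ I.
Proof.
move=> Iz zI; have Iv : parabolic I (z^-1 * w_ I).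
  by apply: parabolicM; [apply: parabolicV|apply: longest_in].
have [_ /(_ z Iz)] := longestP finI.
rewrite (rmax_ell finitaryS zI Iv) mulVKg -{2}(addn0 (len _)) leq_add2l leqn0.
by move=> /eqP /ell_eq0 h; rewrite -[LHS]mulg1 -h mulVKg.
Qed.

Lemma longestV : (w_ I)^-1 = w_ I.
Proof.
apply: rmax_longest; first by apply: parabolicV; apply: longest_in.
by apply/(rmaxV finitaryS); apply: longest_lmax.
Qed.

Lemma longest2 : w_ I * w_ I = 1.
Proof. by rewrite -{1}longestV mulVg. Qed.

Lemma mul_longestK x : x * w_ I * w_ I = x.
Proof. by rewrite -mulA longest2 mulg1. Qed.

Lemma longest_mulK x : w_ I * (w_ I * x) = x.
Proof. by rewrite mulA longest2 mul1g. Qed.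

Lemma ell_longest_mul v : parabolic I v ->
  len (w_ I) = (len (w_ I * v) + len v)%N.
Proof. by apply: rmax_ell; [apply: finitaryS|apply: longest_rmax]. Qed.

Lemma ell_mul_longest v : parabolic I v ->
  len (w_ I) = (len v + len (v * w_ I))%N.
Proof. by apply: lmax_ell; [apply: finitaryS|apply: longest_lmax]. Qed.

Lemma rmin_longest x : rmin I x -> len (x * w_ I) = (len x + len (w_ I))%N.
Proof. by move/rmin_add; apply; [apply: finitaryS|apply: longest_in]. Qed.

Lemma lmin_add x v : lmin I x -> parabolic I v ->
  len (v * x) = (len v + len x)%N.
Proof.
move=> /(rminV finitaryS) h /parabolicV h'.
by rewrite -ellV invgM (rmin_add finitaryS h h') !ellV addnC.
Qed.

Lemma lmin_longest x : lmin I x -> len (w_ I * x) = (len (w_ I) + len x)%N.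
Proof. by move/lmin_add; apply; apply: longest_in. Qed.

Lemma rmin_longest_rmax x : rmin I x -> rmax I (x * w_ I).
Proof.
move=> h s Is; rewrite -mulA (rmin_longest h) (rmin_add finitaryS h).
  by rewrite ltn_add2l longest_rmax.
by apply: parabolicM; [apply: longest_in|apply: parabolic_gen].
Qed.

Lemma rmax_mul_longest z : rmax I z -> rmin I (z * w_ I).
Proof.
move=> h s Is; have Iws : parabolic I (w_ I * s).
  by apply: parabolicM; [apply: longest_in|apply: parabolic_gen].
have := rmax_ell finitaryS h longest_in.
rewrite (rmax_ell finitaryS h Iws) mulA.
by have := longest_rmax Is; lia.
Qed.

Lemma lmax_longest_mul z : lmax I z -> lmin I (w_ I * z).
Proof.
move=> /(rmaxV finitaryS) /rmax_mul_longest h; apply/(rminV finitaryS).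
by rewrite invgM longestV.
Qed.

Lemma lmin_longest_lmax x : lmin I x -> lmax I (w_ I * x).
Proof.
move=> /(rminV finitaryS) /rmin_longest_rmax h; apply/(rmaxV finitaryS).
by rewrite invgM longestV.
Qed.

(** Since w_I absorbs the letters of I, the monoid product with it sees only the coset x W_I. *)
Lemma mul_star_longest x a : parabolic I a -> x * a ** w_ I = x ** w_ I.
Proof.
have step y s : I s -> y * s ** w_ I = y ** w_ I.
  move=> Is; have Ss := finitaryS Is.
  have sw : s ** w_ I = w_ I.
    by apply: star_lmax longest_lmax _; [apply: finitaryS|apply: parabolic_gen].
  have [h|h] := ltnP (len y) (len (y * s)).
    by rewrite -star_simple_lt // -starA sw.
  rewrite leqNgt -ell_lt_neg_r // in h.
  rewrite -[y in RHS](mulsK _ Ss) -[in RHS]star_simple_lt ?mulsK //.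
  by rewrite -starA sw.
move: a; apply: (parabolic_ind finitaryS) => [|w s Is _ _ IH].
  by rewrite mulg1.
by rewrite mulA step.
Qed.

Lemma longest_star_mul x a : parabolic I a -> w_ I ** (a * x) = w_ I ** x.
Proof.
have step y s : I s -> w_ I ** (s * y) = w_ I ** y.
  move=> Is; have Ss := finitaryS Is.
  have ws : w_ I ** s = w_ I.
    by apply: rmax_star longest_rmax _; [apply: finitaryS|apply: parabolic_gen].
  have [h|h] := ltnP (len y) (len (s * y)).
    have -> : s * y = s ** y by rewrite simple_star // h.
    by rewrite starA ws.
  rewrite leqNgt -ell_lt_neg_l // in h.
  have {2}-> : y = s ** (s * y) by rewrite simple_star // mulKs // h.
  by rewrite starA ws.
move: a; apply: (parabolic_indl finitaryS) => [|w s Is _ _ IH].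
  by rewrite mul1g.
by rewrite -mulA step.
Qed.

Lemma lmin_longest_star x : lmin I x -> w_ I ** x = w_ I * x.
Proof. by move=> h; apply: star_add; apply: lmin_longest. Qed.

Lemma rmax_star_longest z : rmax I z -> z ** w_ I = z.
Proof.
by move=> h; apply: rmax_star h _; [apply: finitaryS|apply: longest_in].
Qed.

Lemma lmax_longest_star z : lmax I z -> w_ I ** z = z.
Proof.
by move=> h; apply: star_lmax h _; [apply: finitaryS|apply: longest_in].
Qed.

Lemma star_longest_rmax x : rmax I (x ** w_ I).
Proof.
move=> s Is; have Ss := finitaryS Is; rewrite ell_lt_neg_r //; apply/negP => h.
have : x ** w_ I ** s = x ** w_ I.
  rewrite -starA; congr (_ ** _).
  by apply: rmax_star longest_rmax _; [apply: finitaryS|apply: parabolic_gen].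
by rewrite star_simple_lt // => e; move: h; rewrite e ltnn.
Qed.

Lemma star_longest_coset x : exists2 a, parabolic I a & x ** w_ I = x * a.
Proof.
have : parabolic I (w_ I) by apply: longest_in.
move: (w_ I); apply: (parabolic_ind finitaryS) => [|w s Is Iw e [a Ia ea]].
  by exists 1; [apply: parabolic1|rewrite starw1 mulg1].
have Ss := finitaryS Is; rewrite -(@star_simple_lt w) ?e // starA ea.
rewrite star_simple //; case: ifP => _; last by exists a.
exists (a * s); rewrite ?mulA //; apply: parabolicM => //.
exact: parabolic_gen.
Qed.

Lemma longest_star_coset x : exists2 a, parabolic I a & w_ I ** x = a * x.
Proof.
have : parabolic I (w_ I) by apply: longest_in.
move: (w_ I); apply: (parabolic_indl finitaryS) => [|w s Is Iw e [a Ia ea]].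
  by exists 1; [apply: parabolic1|rewrite star1w mul1g].
have Ss := finitaryS Is.
have -> : s * w = s ** w by rewrite simple_star // e ltnSn.
rewrite -starA ea simple_star //; case: ifP => _; last by exists a.
exists (s * a); rewrite ?mulA //; apply: parabolicM => //.
exact: parabolic_gen.
Qed.

End Longest.

(** * Double cosets and expressions *)

Lemma bruhat_ell x y : bruhat S x y -> x = y \/ (len x < len y)%N.
Proof.
elim=> [u v [_ h]|u|u v w _ [->|h] _ [<-|h']]; try by [left|right].
by right; apply: ltn_trans h h'.
Qed.

Lemma bruhat_simple_r x s : S s -> (len x < len (x * s))%N ->
  bruhat S x (x * s).
Proof.
move=> Ss h; apply: Relation_Operators.rt_step; split=> //.
by exists s => //; exists 1, s; rewrite mul1g invg1 mulg1.
Qed.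

Lemma bruhat_simple_l x s : S s -> (len x < len (s * x))%N ->
  bruhat S x (s * x).
Proof.
move=> Ss h; apply: Relation_Operators.rt_step; split=> //.
exists (x^-1 * s * x); first by exists x^-1, s; rewrite invgK.
by rewrite !mulA mulgV mul1g.
Qed.

Section DoubleCoset.

Variables I J : set W.
Hypotheses (finI : finitary S I) (finJ : finitary S J).

Lemma dcoset_refl x : dcoset I J x x.
Proof.
by exists 1, 1; rewrite mul1g mulg1; split=> //; apply: parabolic1.
Qed.

Lemma dcoset_mull x a y : dcoset I J x y -> parabolic I a ->
  dcoset I J x (a * y).
Proof.
move=> [b [c [Ib Jc ->]]] Ia; exists (a * b), c; split=> //.
  exact: parabolicM.
by rewrite !mulA.
Qed.

Lemma dcoset_mulr x a y : dcoset I J x y -> parabolic J a ->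
  dcoset I J x (y * a).
Proof.
move=> [b [c [Ib Jc ->]]] Ia; exists b, (c * a); split=> //.
  exact: parabolicM.
by rewrite !mulA.
Qed.

Lemma dcoset_star x v : dcoset I J x v -> w_ I ** v ** w_ J = w_ I ** x ** w_ J.
Proof.
move=> [a [b [Ia Jb ->]]].
by rewrite -starA mul_star_longest // starA longest_star_mul.
Qed.

Lemma star_dcoset x : dcoset I J x (w_ I ** x ** w_ J).
Proof.
have [a Ia ->] := longest_star_coset finI x.
have [b Jb ->] := star_longest_coset finJ (a * x).
by exists a, b.
Qed.

(** The right-hand side takes the same value at every v in the coset and is at least as long as v,
    so it is Bruhat-maximal. Conversely, a Bruhat-maximal element has I as left and J as right
    descents, so both longest elements are absorbed by it. *)
Lemma top_dcoset x : top S (dcoset I J x) = w_ I ** x ** w_ J.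
Proof.
set m := w_ I ** x ** w_ J; rewrite /top; set P := (P in xget _ P).
have [pz zmax] : P (xget 1 P).
  apply: (@xgetPex _ 1 P); exists m; split; first exact: star_dcoset.
  move=> y py /bruhat_ell[//|]; rewrite ltnNge /m -(dcoset_star py).
  by rewrite -starA (leq_trans _ (ell_star_r _ _)) // ell_star_l.
move: pz zmax; set z := xget _ _ => pz zmax.
rewrite /m -(dcoset_star pz) lmax_longest_star //.
  rewrite rmax_star_longest // => s Js; have Ss := finitaryS finJ Js.
  rewrite ell_lt_neg_r //; apply/negP => h.
  move: (h); rewrite (zmax (z * s)) ?ltnn //; last exact: bruhat_simple_r.
  by apply: dcoset_mulr => //; apply: parabolic_gen.
move=> s Is; have Ss := finitaryS finI Is.
rewrite ell_lt_neg_l //; apply/negP => h.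
move: (h); rewrite (zmax (s * z)) ?ltnn //; last exact: bruhat_simple_l.
by apply: dcoset_mull => //; apply: parabolic_gen.
Qed.

Lemma bottom_dcoset x :
  dcoset I J x (bottom S (dcoset I J x)) /\ lmin I (bottom S (dcoset I J x)).
Proof.
rewrite /bottom; set P := (P in xget _ P).
have [pz zmin] : P (xget 1 P).
  apply: (@xgetPex _ 1 P).
  have ex : exists n, `[< exists2 u, dcoset I J x u & len u = n >].
    by exists (len x); apply/asboolP; exists x => //; apply: dcoset_refl.
  case: (ex_minnP ex) => _ /asboolP[u pu <-] umin; exists u; split=> //.
  move=> y py /bruhat_ell[//|]; rewrite ltnNge umin //.
  by apply/asboolP; exists y.
split=> // s Is; have Ss := finitaryS finI Is; move: pz zmin.
set z := xget _ _ => pz zmin; rewrite ltnNge leq_eqVlt negb_or; apply/andP.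
have h : ~~ (len (s * z) < len z)%N.
  apply/negP => h; move: (h); rewrite (zmin (s * z)) ?ltnn //.
    by apply: dcoset_mull => //; apply: parabolic_gen.
  by rewrite -{2}(mulKs z Ss); apply: bruhat_simple_l; rewrite ?mulKs.
by split=> //; case: (ell_simple z Ss); lia.
Qed.

End DoubleCoset.

(** * Expressions, their maximal elements and reducedness *)

Implicit Types Ks : seq (set W).

Definition all_finitary Ks := forall K, List.In K Ks -> finitary S K.

Lemma dcoset_eq I J x y : dcoset I J x y -> dcoset I J y = dcoset I J x.
Proof.
move=> [a [b [Ia Jb ->]]]; apply/seteqP; split=> _ [c [d [Ic Jd ->]]].
  by exists (c * a), (b * d); split; rewrite ?mulA //; apply: parabolicM.
exists (c * a^-1), (b^-1 * d); split.
- by apply: parabolicM => //; apply: parabolicV.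
- by apply: parabolicM => //; apply: parabolicV.
by rewrite !mulA mulgVK -!mulA (mulA b) mulgV mul1g.
Qed.

Lemma longest_star I : finitary S I -> w_ I ** w_ I = w_ I.
Proof. by move=> fI; rewrite rmax_star_longest //; apply: longest_rmax. Qed.

Lemma sub_longest_star I J : finitary S J -> I `<=` J -> w_ I ** w_ J = w_ J.
Proof.
move=> fJ IJ; rewrite lmax_longest_star //; first exact: finitary_sub fJ IJ.
by move=> s /IJ; apply: longest_lmax.
Qed.

Lemma longest_star_sub I J : finitary S J -> I `<=` J -> w_ J ** w_ I = w_ J.
Proof.
move=> fJ IJ; rewrite rmax_star_longest //; first exact: finitary_sub fJ IJ.
by move=> s /IJ; apply: longest_rmax.
Qed.

Definition star_all z (Ks : seq (set W)) := foldl (fun z I => z ** w_ I) z Ks.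

Lemma compose_along_star I J z Ks : finitary S I -> finitary S J ->
  all_finitary Ks -> w_ I ** z = z -> z ** w_ J = z ->
  compose_along S I J (dcoset I J z) Ks = dcoset I (last J Ks) (star_all z Ks).
Proof.
move=> fI; elim: Ks J z => [//|K Ks IH] J z fJ fl zI zJ /=.
have fK : finitary S K by apply: fl; left.
rewrite /compose !top_dcoset // starw1 zI zJ starA zJ; apply: IH => //.
- by move=> L Ll; apply: fl; right.
- by rewrite starA zI.
- by rewrite -starA longest_star.
Qed.

Lemma expressedE I Ks : finitary S I -> all_finitary Ks ->
  expressed S (I :: Ks) = dcoset I (last I Ks) (star_all (w_ I) Ks).
Proof.
case: Ks => [|J Ks] fI fl /=.
  apply/seteqP; split=> [x Ix|_ [a [b [Ia Ib ->]]]].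
    exists x, (w_ I); rewrite mul_longestK //; split=> //.
    exact: longest_in.
  by apply: parabolicM => //; apply: parabolicM => //; apply: longest_in.
have fJ : finitary S J by apply: fl; left.
rewrite -(dcoset_eq (star_dcoset fI fJ 1)) starw1 compose_along_star //.
- by move=> K Kl; apply: fl; right.
- by rewrite starA longest_star.
- by rewrite -starA longest_star.
Qed.

Lemma star_all_longest I Ks : finitary S I -> all_finitary Ks ->
  w_ I ** star_all (w_ I) Ks = star_all (w_ I) Ks /\
  star_all (w_ I) Ks ** w_ (last I Ks) = star_all (w_ I) Ks.
Proof.
move=> fI; elim/last_ind: Ks => [|Ks K IH] fl /=; first by rewrite longest_star.
have [|h _] := IH.
  by move=> L Ll; apply: fl; rewrite -cats1; apply: List.in_or_app; left.
rewrite /star_all foldl_rcons last_rcons -/(star_all _ Ks) starA h; split=> //.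
rewrite -starA longest_star //; apply: fl.
by rewrite -cats1; apply: List.in_or_app; right; left.
Qed.

Lemma top_expressed I Ks : finitary S I -> all_finitary Ks ->
  top S (expressed S (I :: Ks)) = star_all (w_ I) Ks.
Proof.
move=> fI fl; have [h1 h2] := star_all_longest fI fl.
rewrite expressedE // top_dcoset // ?h1 ?h2 //.
case: (lastP Ks) fl => [//|Ks' K] fl; rewrite last_rcons; apply: fl.
by rewrite -cats1; apply: List.in_or_app; right; left.
Qed.

(** Here z stands for the maximal element of the coset expressed so far, and [w_ J ** w_ K] is that
    of W_J e W_K. *)
Definition reduced_step z J K :=
  len (z * w_ J * (w_ J ** w_ K)) = (len (z * w_ J) + len (w_ J ** w_ K))%N.

Fixpoint reduced_from z J (Ks : seq (set W)) :=
  if Ks is K :: Ks' then reduced_step z J K /\ reduced_from (z ** w_ K) K Ks'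
  else True.

Lemma reduced_fromP z J Ks : reduced_from z J Ks <->
  forall i, (i < size Ks)%N ->
    reduced_step (star_all z (take i Ks)) (nth set0 (J :: Ks) i)
      (nth set0 Ks i).
Proof.
elim: Ks z J => [|K Ks IH] z J /=; first by split.
split=> [[h /IH hl] [|i]|h].
- by rewrite take0.
- exact: hl.
split; first by have := h 0%N isT; rewrite take0.
by apply/IH => i; apply: (h i.+1).
Qed.

Lemma expression_cons I J Ks : expression S (I :: J :: Ks) <->
  [/\ finitary S I, adjacent I J & expression S (J :: Ks)].
Proof.
split=> [[_ fin adj]|[fI aIJ [_ fin adj]]].
  split; [exact: (fin 0%N)|exact: (adj 0%N)|].
  by split=> // i; [apply: (fin i.+1)|apply: (adj i.+1)].
by split=> // -[//|i]; [apply: fin|apply: adj].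
Qed.

Lemma expression_finitary I Ks : expression S (I :: Ks) ->
  finitary S I /\ all_finitary Ks.
Proof.
move=> [_ fin _]; split; first exact: (fin 0%N).
elim: Ks I fin => [//|J Ks IH] I fin K [<-|]; first exact: (fin 1%N).
by apply: (IH J) => i; apply: (fin i.+1).
Qed.

Lemma reducedP I Ks : expression S (I :: Ks) ->
  reduced S (I :: Ks) <-> reduced_from (w_ I) I Ks.
Proof.
move=> eIl; have [fI fl] := expression_finitary eIl.
have [_ fin _] := eIl.
have step i : (i < size Ks)%N ->
    reduced_compose S (nth set0 (I :: Ks) i) (expressed S (take i.+1 (I :: Ks)))
      (dcoset (nth set0 (I :: Ks) i) (nth set0 (I :: Ks) i.+1) 1) <->
    reduced_step (star_all (w_ I) (take i Ks)) (nth set0 (I :: Ks) i)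
      (nth set0 Ks i).
  move=> lti; rewrite /reduced_compose [take _ _]/= top_expressed //.
    by rewrite top_dcoset ?starw1 ?longestV //; apply: fin => //=; apply: ltnW.
  move=> K Kl; apply: fl; rewrite -(cat_take_drop i Ks).
  by apply: List.in_or_app; left.
split=> [[_ h]|/reduced_fromP h].
  apply/reduced_fromP => -[|i] lti; last exact/(step _ lti)/h.
  (* Index 0 is absent from [reduced]; it holds automatically since w_I w_I = 1. *)
  rewrite take0 /reduced_step /= longest2 // mul1g ell1 //.
by split=> // i _ lti; apply/step/h.
Qed.

(** * Atoms *)

Definition conj_set A z : set W := [set s ^ z | s in A].

Lemma conj_setM A x y : conj_set (conj_set A x) y = conj_set A (x * y).
Proof.
apply/seteqP; split=> [_ [_ [s As <-] <-]|_ [s As <-]].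
  by exists s; rewrite ?conjgM.
by exists (s ^ x); [exists s|rewrite conjgM].
Qed.

Lemma conj_setK A z : conj_set (conj_set A z) z^-1 = A.
Proof.
rewrite conj_setM mulgV; apply/seteqP; split=> [_ [s As <-]|s As].
  by rewrite conjg1.
by exists s; rewrite ?conjg1.
Qed.

Lemma parabolic_conj A z v : A `<=` S -> parabolic A v ->
  parabolic (conj_set A z) (v ^ z).
Proof.
move=> AS; move: v; apply: (parabolic_ind AS) => [|w s As _ _ IH].
  by rewrite conj1g; apply: parabolic1.
by rewrite conjMg; apply: parabolicM => //; apply: parabolic_gen; exists s.
Qed.

(** Conjugating a reduced word letter by letter gives a word over S of the same length, and z^-1
    conjugates back. *)
Lemma ell_conj A z v : A `<=` S -> conj_set A z `<=` S -> parabolic A v ->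
  len (v ^ z) = len v.
Proof.
have le B y x : B `<=` S -> conj_set B y `<=` S -> parabolic B x ->
    (len (x ^ y) <= len x)%N.
  move=> BS ByS; move: x; apply: (parabolic_ind BS) => [|w s Bs _ e IH].
    by rewrite conj1g.
  have Ss : S (s ^ y) by apply: ByS; exists s.
  by rewrite conjMg e; apply: leq_trans (ell_simple_le_r _ Ss) _.
move=> AS AzS Av; apply/eqP; rewrite eqn_leq (le A) //=.
rewrite -{1}(conjgK z v); apply: (le (conj_set A z)); rewrite ?conj_setK //.
exact: parabolic_conj.
Qed.

Lemma conj_set_rmax A z v : A `<=` S -> conj_set A z `<=` S -> parabolic A v ->
  rmax A v -> rmax (conj_set A z) (v ^ z).
Proof.
move=> AS AzS Av vA _ [s As <-]; rewrite -conjMg !(ell_conj AS AzS) ?vA //.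
by apply: parabolicM => //; apply: parabolic_gen.
Qed.

Lemma finitary_conj A z : finitary S A -> conj_set A z `<=` S ->
  finitary S (conj_set A z).
Proof.
move=> fA AzS; have AS := finitaryS fA.
have finA := finite_image (fun s => s ^ z) (finitary_finite fA).
apply: (rmax_finitary AzS finA).
exact: conj_set_rmax AS AzS (longest_in fA) (longest_rmax fA).
Qed.

Lemma longest_conj A z : finitary S A -> conj_set A z `<=` S ->
  w_ (conj_set A z) = (w_ A) ^ z.
Proof.
move=> fA AzS; have AS := finitaryS fA; apply/esym/rmax_longest.
- exact: finitary_conj.
- by apply: parabolic_conj => //; apply: longest_in.
- by apply: conj_set_rmax => //; [apply: longest_in|apply: longest_rmax].
Qed.

Lemma parabolic_ell1 A x : A `<=` S -> parabolic A x -> len x = 1%N -> A x.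
Proof.
move=> AS Ax; have [->|[w [s [As _ -> ->]]]] := last_letter AS Ax.
  by rewrite ell1.
by case=> /ell_eq0 ->; rewrite mul1g.
Qed.

Lemma ell_simple1 s : S s -> len s = 1%N.
Proof.
move=> Ss; have [] := ell_simple 1 Ss; rewrite mulg1 ell1 //.
Qed.

(** Exchange writes sv as a word over A, so s lies in W_A and has length 1. *)
Lemma parabolic_ldesc A s v : A `<=` S -> parabolic A v -> S s ->
  (len (s * v) <= len v)%N -> A s.
Proof.
move=> AS Av Ss; have [l [Al ev _]] := parabolic_reduced_word AS Av.
rewrite ev => le; have Sl : letters_in S l by move=> t /Al /AS.
have [i _ e] := exchange_word Ss Sl le.
apply: (parabolic_ell1 AS) (ell_simple1 Ss).
rewrite -[s](mulgK v) ev e; apply: parabolicM.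
  exact: parabolic_wprod (letters_in_delete Al).
by rewrite -ev; apply: parabolicV.
Qed.

Section LongestConj.
Variable P : set W.
Hypothesis fP : finitary S P.

Lemma conj_longestE x : x ^ w_ P = w_ P * x * w_ P.
Proof. by rewrite conjgE longestV // mulA. Qed.

Lemma conj_longestK x : (x ^ w_ P) ^ w_ P = x.
Proof. by rewrite -conjgM longest2 // conjg1. Qed.

Lemma conj_longest_in s : P s -> P (s ^ w_ P).
Proof.
move=> Ps; have Ws := parabolic_gen Ps; have Ww := longest_in fP.
have PS := finitaryS fP.
apply: (parabolic_ell1 PS).
  by rewrite conj_longestE; do !apply: parabolicM.
have Wws : parabolic P (w_ P * s) by apply: parabolicM.
rewrite conj_longestE.
have := ell_mul_longest fP Wws; have := ell_longest_mul fP Ws.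
by rewrite (ell_simple1 (PS _ Ps)); lia.
Qed.

Lemma conj_set_longest : conj_set P (w_ P) = P.
Proof.
apply/seteqP; split=> [_ [s Ps <-]|s Ps]; first exact: conj_longest_in.
by exists (s ^ w_ P); [apply: conj_longest_in|rewrite conj_longestK].
Qed.

Lemma ell_conj_longest x : parabolic P x -> len (x ^ w_ P) = len x.
Proof.
by apply: ell_conj; rewrite ?conj_set_longest; apply: finitaryS.
Qed.

End LongestConj.

(** * Single atoms and lists of atoms *)

Definition next I a : set W := (a |` I) `\ (a ^ w_ (a |` I)).
(** The minimal element of the atomic coset expressed by [I + a - t], with t the conjugate of a by
    w_{Ia}. *)
Definition atom I a := w_ I * w_ (a |` I).

Section Atom.
Variables (I : set W) (a : W).
Hypotheses (nIa : ~ I a) (fP : finitary S (a |` I)).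
Local Notation P := (a |` I).

Let IP : I `<=` P. Proof. by move=> s; right. Qed.
Let Pa : P a. Proof. by left. Qed.

Lemma atom_finitary : finitary S I. Proof. exact: finitary_sub fP IP. Qed.

Let PwI : parabolic P (w_ I).
Proof. exact: sub_parabolic IP (longest_in atom_finitary). Qed.

(** Conjugation by w_P permutes P, so removing the image of a leaves the image of I. *)
Lemma nextE : next I a = conj_set I (w_ P).
Proof.
apply/seteqP; split=> [s [Ps nsa]|_ [s Is <-]].
  have [e|Is] := conj_longest_in fP Ps.
    by case: nsa; rewrite /= -[LHS](conj_longestK fP) e.
  by exists (s ^ w_ P); rewrite ?conj_longestK.
split; first exact: (conj_longest_in fP (IP Is)).
by move=> /conjg_inj e; apply: nIa; rewrite -e.
Qed.

Lemma next_sub : next I a `<=` P. Proof. by move=> s []. Qed.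

Lemma next_finitary : finitary S (next I a).
Proof. exact: finitary_sub fP next_sub. Qed.

Lemma longest_next : w_ (next I a) = (w_ I) ^ w_ P.
Proof.
rewrite nextE longest_conj //; first exact: atom_finitary.
by rewrite -nextE; apply: finitaryS next_finitary.
Qed.

Lemma atomE : atom I a = w_ P * w_ (next I a).
Proof.
by rewrite longest_next conj_longestE // !mulA longest2 // mul1g.
Qed.

Lemma conj_set_atom : conj_set I (atom I a) = next I a.
Proof.
by rewrite -conj_setM (conj_set_longest atom_finitary) nextE.
Qed.

Lemma atom_in : parabolic P (atom I a).
Proof.
by apply: parabolicM; last exact: longest_in.
Qed.

Lemma ell_atom : len (w_ P) = (len (w_ I) + len (atom I a))%N.
Proof.
exact: ell_mul_longest.
Qed.

Lemma ell_atom_next : len (w_ P) = (len (atom I a) + len (w_ (next I a)))%N.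
Proof.
rewrite atomE; apply: ell_longest_mul => //.
exact: sub_parabolic next_sub (longest_in next_finitary).
Qed.

(** As a is not in I, it lengthens w_I; and the length of v w_P is that of w_P minus that of v for v
    in W_P. *)
Lemma atom_ldesc : (len (a * atom I a) < len (atom I a))%N.
Proof.
have fI := atom_finitary; have IS := finitaryS fI.
have Sa : S a := finitaryS fP Pa.
have : (len (w_ I) < len (a * w_ I))%N.
  rewrite ltnNge; apply/negP => /(parabolic_ldesc IS (longest_in fI) Sa).
  exact: nIa.
have awI : parabolic P (a * w_ I).
  by apply: parabolicM => //; apply: parabolic_gen.
by have := ell_mul_longest fP awI; rewrite -mulA -/(atom I a) ell_atom; lia.
Qed.

Lemma atom_gt0 : (0 < len (atom I a))%N.
Proof. exact: leq_ltn_trans atom_ldesc. Qed.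

End Atom.

(* [atomic_expr I [:: a1; a2; ...]] is [I + a1 - t1 + a2 - t2 ...], where each
   t_i is forced by the step being an atom. *)
Fixpoint atomic_tail I l : seq (set W) :=
  if l is a :: l' then [:: a |` I, next I a & atomic_tail (next I a) l']
  else [::].

Definition atomic_expr I l := I :: atomic_tail I l.

Fixpoint valid I l : Prop :=
  if l is a :: l' then [/\ ~ I a, finitary S (a |` I) & valid (next I a) l']
  else True.

Definition target I l := foldl next I l.

Fixpoint elem I l : W :=
  if l is a :: l' then atom I a * elem (next I a) l' else 1.

Fixpoint weight I l : nat :=
  if l is a :: l' then len (atom I a) + weight (next I a) l' else 0.

(** Additivity of length over the atoms; [reduced_atomic] identifies it with reducedness of the
    expression. *)
Definition tight I l := len (elem I l) = weight I l.

Lemma atomic_tail_cat I l l' :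
  atomic_tail I (l ++ l') = atomic_tail I l ++ atomic_tail (target I l) l'.
Proof. by elim: l I => //= a l IH I; rewrite IH. Qed.

Lemma valid_cat I l l' :
  valid I (l ++ l') <-> valid I l /\ valid (target I l) l'.
Proof.
elim: l I => [|a l IH] I /=; first by split=> // -[].
by split=> [[? ? /IH[]]|[[? ? ?] ?]] //; split=> //; apply/IH.
Qed.

Lemma elem_cat I l l' : elem I (l ++ l') = elem I l * elem (target I l) l'.
Proof. by elim: l I => [|a l IH] I /=; rewrite ?mul1g // IH mulA. Qed.

Lemma weight_cat I l l' :
  weight I (l ++ l') = (weight I l + weight (target I l) l')%N.
Proof. by elim: l I => [|a l IH] I //=; rewrite IH addnA. Qed.

Lemma ell_elem_le I l : (len (elem I l) <= weight I l)%N.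
Proof.
elim: l I => [|a l IH] I /=; first by rewrite ell1.
by apply: leq_trans (ellM _ _) _; rewrite leq_add2l.
Qed.

Lemma tight_cat I l l' :
  tight I (l ++ l') -> tight I l /\ tight (target I l) l'.
Proof.
rewrite /tight elem_cat weight_cat => e.
have := ell_elem_le I l; have := ell_elem_le (target I l) l'.
by have := ellM (elem I l) (elem (target I l) l'); lia.
Qed.

Lemma conj_set_elem I l : valid I l -> conj_set I (elem I l) = target I l.
Proof.
elim: l I => [|a l IH] I /=.
  by move=> _; rewrite -[RHS](conj_setK I 1) conj_setM mulgV.
by move=> [nIa fP /IH <-]; rewrite -conj_setM conj_set_atom.
Qed.

Lemma target_finitary I l : finitary S I -> valid I l ->
  finitary S (target I l).
Proof.
elim: l I => [//|a l IH] I fI [nIa fP /IH]; apply; exact: next_finitary.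
Qed.

Lemma weight_size I l : valid I l -> (size l <= weight I l)%N.
Proof.
elim: l I => [//|a l IH] I /= [nIa fP /IH h].
by have := atom_gt0 nIa fP; lia.
Qed.

Lemma last_atomic_tail I l : last I (atomic_tail I l) = target I l.
Proof. by elim: l I => //= a l IH I; rewrite IH. Qed.

(** * Reduced atomic expressions as length-additive products *)

Lemma atomic_expression I l : finitary S I -> valid I l ->
  expression S (atomic_expr I l).
Proof.
elim: l I => [|a l IH] I fI /=; first by split=> // -[|[]].
move=> [nIa fP vl]; apply/expression_cons; split=> //; first by exists a; left.
apply/expression_cons; split=> //.
  exists (a ^ w_ (a |` I)); right; split=> //.
  by apply: conj_longest_in => //; left.
by apply: IH => //; apply: next_finitary.
Qed.

Lemma mul_longest_atom I a x : ~ I a -> finitary S (a |` I) ->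
  x * w_ (a |` I) = x * atom I a * w_ (next I a).
Proof.
move=> nIa fP; rewrite (atomE nIa fP) !mulA mul_longestK //.
exact: next_finitary.
Qed.

(** If lengths add with the atom, which has a as a left descent, then a is not a right descent of x,
    and x is minimal for all of Ia. Conversely, w_{Ia} is the length-additive product of the atom
    and the longest element of the next subset. *)
Lemma ell_mul_atom I a x : ~ I a -> finitary S (a |` I) -> rmin I x ->
  len (x * atom I a) = (len x + len (atom I a))%N <->
  len (x * w_ (a |` I)) = (len x + len (w_ (a |` I)))%N.
Proof.
move=> nIa fP xI; have lenP := ell_atom_next nIa fP; split=> h.
  apply: rmin_longest => // s [->|/xI//].
  rewrite ltnNge; apply/negP => le; have := ellM (x * a) (a * atom I a).
  rewrite mulA mulsK; last by apply: (finitaryS fP); left.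
  by rewrite h; have := atom_ldesc nIa fP; lia.
have := ellM (x * atom I a) (w_ (next I a)); have := ellM x (atom I a).
by rewrite -mul_longest_atom // h lenP; lia.
Qed.

Lemma rmin_mul_atom I a x : ~ I a -> finitary S (a |` I) ->
  len (x * w_ (a |` I)) = (len x + len (w_ (a |` I)))%N ->
  rmin (next I a) (x * atom I a).
Proof.
move=> nIa fP h; rewrite -[x * _](mul_longestK (next_finitary fP)).
rewrite -mul_longest_atom // -(star_add h).
apply: rmax_mul_longest; first exact: next_finitary.
by move=> s /next_sub; apply: star_longest_rmax.
Qed.

(** Adding a is a reduced step exactly when lengths add in x w_{Ia}, and the removal that follows is
    always reduced. Then x times the atom is right minimal for the next subset, so the recursion
    continues from it. *)
Lemma reduced_from_atomic I l x : finitary S I -> valid I l -> rmin I x ->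
  reduced_from (x * w_ I) I (atomic_tail I l) <->
  len (x * elem I l) = (len x + weight I l)%N.
Proof.
elim: l I x => [|a l IH] I x fI /=; first by rewrite mulg1 addn0.
move=> [nIa fP vl] xI; have fI' := next_finitary fP.
have IP : I `<=` a |` I by move=> s; right.
have I'P := @next_sub I a.
have PwI := sub_parabolic IP (longest_in fI).
rewrite /reduced_step !mul_longestK // sub_longest_star // longest_star_sub //.
rewrite mul_star_longest //.
have -> : x ** w_ (a |` I) ** w_ (next I a) = x ** w_ (a |` I).
  by rewrite -starA longest_star_sub.
split=> [[h [_]]|h].
  have x'min := rmin_mul_atom nIa fP h.
  rewrite (star_add h) mul_longest_atom // => /(IH _ _ fI' vl x'min).
  by rewrite mulA => ->; rewrite (proj2 (ell_mul_atom nIa fP xI) h) addnA.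
have h' : len (x * atom I a) = (len x + len (atom I a))%N.
  have := ellM (x * atom I a) (elem (next I a) l); have := ellM x (atom I a).
  by have := ell_elem_le (next I a) l; rewrite -mulA h; lia.
have {}h' := proj1 (ell_mul_atom nIa fP xI) h'.
have x'min := rmin_mul_atom nIa fP h'.
rewrite (star_add h'); split=> //; split; first by rewrite !mul_longestK // h'.
rewrite mul_longest_atom //; apply/(IH _ _ fI' vl x'min).
by rewrite -mulA h (proj2 (ell_mul_atom nIa fP xI) h') addnA.
Qed.

Lemma tight_star_all I l x : finitary S I -> valid I l -> rmin I x ->
  len (x * elem I l) = (len x + weight I l)%N ->
  star_all (x * w_ I) (atomic_tail I l) = x * elem I l * w_ (target I l) /\
  rmin (target I l) (x * elem I l).
Proof.
elim: l I x => [|a l IH] I x fI /=; first by rewrite mulg1.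
move=> [nIa fP vl] xI h; have fI' := next_finitary fP.
have IP : I `<=` a |` I by move=> s; right.
have h' : len (x * atom I a) = (len x + len (atom I a))%N.
  have := ellM (x * atom I a) (elem (next I a) l); have := ellM x (atom I a).
  by have := ell_elem_le (next I a) l; rewrite -mulA h; lia.
have h2 := proj1 (ell_mul_atom nIa fP xI) h'.
have x'min := rmin_mul_atom nIa fP h2.
rewrite mul_star_longest //; last exact: sub_parabolic IP (longest_in fI).
rewrite -starA longest_star_sub //; last exact: next_sub.
rewrite (star_add h2) mul_longest_atom // mulA; apply: IH => //.
by rewrite -mulA h h' addnA.
Qed.

Lemma rmin1 A : A `<=` S -> rmin A 1.
Proof. by move=> AS s /AS Ss; rewrite mul1g ell1 (ell_simple1 Ss). Qed.

Lemma reduced_atomic I l : finitary S I -> valid I l ->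
  reduced S (atomic_expr I l) <-> tight I l.
Proof.
move=> fI vl; have h := rmin1 (finitaryS fI).
apply: iff_trans (reducedP (atomic_expression fI vl)) _.
by have := reduced_from_atomic fI vl h; rewrite !mul1g ell1.
Qed.

Lemma expressed_atomic I l : finitary S I -> valid I l -> tight I l ->
  expressed S (atomic_expr I l) =
    dcoset I (target I l) (elem I l * w_ (target I l)) /\
  top S (expressed S (atomic_expr I l)) = elem I l * w_ (target I l).
Proof.
move=> fI vl tl; have h := rmin1 (finitaryS fI).
have [_ fin] := expression_finitary (atomic_expression fI vl).
have := tight_star_all fI vl h; rewrite !mul1g ell1 => /(_ tl)[e _].
by rewrite top_expressed // expressedE // e last_atomic_tail.
Qed.

(** The product conjugates I to the target, which turns right minimality for the target into left
    minimality for I. *)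
Lemma tight_lmin I l : finitary S I -> valid I l -> tight I l ->
  lmin I (elem I l).
Proof.
move=> fI vl tl; have h := rmin1 (finitaryS fI).
have := tight_star_all fI vl h; rewrite !mul1g ell1 => /(_ tl)[_ emin] s Is.
have := emin (s ^ elem I l); rewrite conjgE mulVKg; apply.
by rewrite -conj_set_elem //; exists s.
Qed.

(** The core condition says that the minimal element B conjugates I to J, so it suffices to show
    that B is w_I w_P. *)
Lemma atom_step_next I P J : finitary S I -> atom_step S I P J ->
  exists a, [/\ ~ I a, finitary S (a |` I), P = a |` I & J = next I a].
Proof.
move=> fI [a [b [[-> ->] /expression_cons[_ [c adj] expP] [[_ core] _]]]].
have nIa : ~ I a.
  move=> Ia; have e : a |` I = I by apply/setUidPr => _ ->.
  case: adj => -[Ic]; rewrite e => {e}e; first by apply: Ic; rewrite e; left.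
  by move: Ic; rewrite e => -[_]; apply.
have [fP fJ] := expression_finitary expP.
exists a; split=> //; set P' := a |` I in fP fJ core *.
set J' := P' `\ b in fJ core *.
have {}fJ : finitary S J' by apply: fJ; left.
have fin : all_finitary [:: P'; J'] by move=> K [<-|[<-|[]]].
have IP : I `<=` P' by move=> s; right.
have JP : J' `<=` P' by move=> s [].
move: core; rewrite expressedE //= sub_longest_star // longest_star_sub //.
have [bp bI] := bottom_dcoset J' fI (w_ P').
move: bp bI; set B := bottom _ _ => bp bI core.
have coreJ : conj_set I B = J'.
  rewrite core; apply/seteqP; split=> [_ [_ [s Js <-] <-]|s Js].
    by rewrite conjgE !mulA mulVg mul1g mulgVK.
  by exists (B * s * B^-1); [exists s|rewrite conjgE !mulA mulVg mul1g mulgVK].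
suff eB : B = atom I a by rewrite -coreJ eB conj_set_atom.
have [u [v [Iu Jv e]]] : dcoset I J' B (w_ P').
  by rewrite (dcoset_eq bp); apply: dcoset_refl.
(* Coreness moves the right factor v across B into W_I, so w_P lies in W_I B; as B is left
   I-minimal, w_P = w_I B. *)
have IvB : parabolic I (v ^ B^-1).
  rewrite -[I](conj_setK I B) coreJ.
  by apply: parabolic_conj => //; apply: finitaryS.
have {}e : w_ P' = u * (v ^ B^-1) * B.
  by rewrite e conjgE invgK !mulA mulgVK.
have := sub_longest_star fP IP; rewrite {1}e longest_star_mul //; last first.
  exact: parabolicM.
rewrite lmin_longest_star // /atom => <-.
by rewrite longest_mulK.
Qed.

Lemma atomic_from_valid I Ks : finitary S I -> atomic_from S I Ks ->
  exists2 l, valid I l & Ks = atomic_tail I l.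
Proof.
have [n] := ubnP (size Ks); elim: n I Ks => // n IH I [|P [|J Ks]] //= sz fI.
  by exists [::].
move=> [/(atom_step_next fI)[a [nIa fP -> ->]] /IH[||l vl ->]].
- by rewrite ltnS in sz; apply: leq_trans sz; rewrite leqW.
- exact: next_finitary.
by exists (a :: l).
Qed.

(* [w_I x = x w_J] has every element of P as a left descent. *)
Lemma core_factor I P x :
  finitary S I -> I `<=` P -> P `<=` S -> finite_set P ->
  lmin I x -> conj_set I x `<=` S ->
  (forall s, P s -> ~ I s -> (len (s * x) < len x)%N) ->
  exists y, [/\ finitary S P, lmin P y, x = w_ I * w_ P * y
              & len x = (len (w_ I * w_ P) + len y)%N].
Proof.
move=> fI IP PS finP xI IxS xP.
have IS := finitaryS fI; have wIS := longest_in fI.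
have ewx : w_ I * x = x * w_ (conj_set I x).
  by rewrite longest_conj // conjgE mulVKg.
have lwx := lmin_longest fI xI.
have wxP : lmax P (w_ I * x).
  move=> s Ps; have [Is|nIs] := pselect (I s).
    exact: lmin_longest_lmax Is.
  rewrite lwx ewx mulA; apply: leq_ltn_trans (ellM _ _) _.
  by rewrite longest_conj // (ell_conj IS IxS) // addnC ltn_add2l xP.
have fP := rmax_finitary PS finP (proj2 (rmaxV PS _) wxP).
exists (w_ P * (w_ I * x)); split=> //.
- exact: lmax_longest_mul.
- by rewrite -mulA longest_mulK // longest_mulK.
have PwI := sub_parabolic IP wIS.
have := lmax_ell PS wxP (longest_in fP); rewrite (ell_mul_longest fP PwI) lwx.
by lia.
Qed.

(** Any left descent a of x lies outside I, and [core_factor] for Ia peels off the atom it starts.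
    The main induction uses this to express the cofactor y. *)
Lemma exists_tight I x : finitary S I -> lmin I x -> conj_set I x `<=` S ->
  exists l, [/\ valid I l, tight I l & elem I l = x].
Proof.
have [n] := ubnP (len x); elim: n I x => // n IH I x lex fI xI IxS.
have [x1|[w [a [Sa _ ex ea]]]] :=
  last_letter (@subset_refl _ S) (parabolicS x^-1).
  exists [::]; split; rewrite // /tight /= ?ell1 //.
  by rewrite -[x]invgK x1 invg1.
have ax : (len (a * x) < len x)%N.
  by rewrite -ellV -(ellV x) ea invgM ex simpleV // mulsK.
have nIa : ~ I a by move=> /xI; rewrite ltnNge ltnW.
have [||||y [fP yP xe xl]] := core_factor (P := a |` I) fI _ _ _ xI IxS.
- by move=> s; right.
- by move=> s [->//|]; apply: finitaryS.
- by rewrite finite_setU; split; [exact: finite_set1|exact: finitary_finite].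
- by move=> s [->|//].
rewrite -/(atom I a) in xe xl.
have [||||l [vl tl el]] := IH (next I a) y.
- by have := atom_gt0 nIa fP; lia.
- exact: next_finitary.
- by move=> s /next_sub; apply: yP.
- by rewrite -conj_set_atom // conj_setM -xe.
by exists (a :: l); split; rewrite // /tight /= el -?xe // xl -el tl.
Qed.

Lemma tight_rmin I l : finitary S I -> valid I l -> tight I l ->
  rmin (target I l) (elem I l).
Proof.
move=> fI vl tl; have h := rmin1 (finitaryS fI).
by have := tight_star_all fI vl h; rewrite !mul1g ell1 => /(_ tl)[].
Qed.

Lemma atom_rdesc I a : ~ I a -> finitary S (a |` I) ->
  (len (atom I a * a ^ w_ (a |` I)) < len (atom I a))%N.
Proof.
move=> nIa fP; have IP : I `<=` a |` I by move=> s; right.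
have fI := finitary_sub fP IP.
have Sa : S a by apply: (finitaryS fP); left.
have wIa : parabolic (a |` I) (w_ I * a).
  apply: parabolicM; first exact: sub_parabolic IP (longest_in fI).
  by apply: parabolic_gen; left.
have -> : atom I a * a ^ w_ (a |` I) = w_ I * a * w_ (a |` I).
  by rewrite conj_longestE // /atom !mulA mul_longestK.
have := ell_mul_longest fP wIa; rewrite (ell_atom fP).
suff : (len (w_ I) < len (w_ I * a))%N by lia.
rewrite -(ell_simpleV _ Sa) longestV // ltnNge; apply/negP.
by move=> /(parabolic_ldesc (finitaryS fI) (longest_in fI) Sa).
Qed.

Lemma longest_sub_inj I M : finitary S M -> I `<=` M -> w_ I = w_ M -> M `<=` I.
Proof.
move=> fM IM e s Ms; have fI := finitary_sub fM IM.
apply: (parabolic_ldesc (finitaryS fI) (longest_in fI) (finitaryS fM Ms)).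
by rewrite e ltnW // longest_lmax.
Qed.

(** * The rank two relations *)

Section Rotation.

Variables (M : set W) (s t : W).
Hypotheses (fM : finitary S M) (Ms : M s) (Mt : M t) (st : t <> bar S M s).

(* [c n] is u_{n-1}, so the step number i of the left-hand side goes from
   [base i = M - u_{i-1} - u_i] to [base i.+1]. *)
Local Notation c := (rotation S M s t).
Local Notation base i := (M `\` [set c i.+1; c i]).

Lemma rotation_pairE n : rotation_pair S M s t n = (c n, c n.+1).
Proof.
rewrite /rotation /=; case: (rotation_pair S M s t n) => a b //.
Qed.

Lemma rotationSS n : c n.+2 = w_ (M `\ c n.+1) * c n * w_ (M `\ c n.+1).
Proof.
have := rotation_pairE n.+1; rewrite [rotation_pair _ _ _ _ _]/= rotation_pairE.
by case.
Qed.

Lemma setD1_finitary x : finitary S (M `\ x).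
Proof. by apply: finitary_sub fM _ => y []. Qed.

Lemma rotationJ n : c n.+2 = c n ^ w_ (M `\ c n.+1).
Proof. by rewrite rotationSS conj_longestE //; apply: setD1_finitary. Qed.

Lemma rotation_in n : [/\ M (c n), M (c n.+1) & c n <> c n.+1].
Proof.
elim: n => [|n [Mn Mn1 neq]].
  have e : c 0 = t ^ w_ M by rewrite /rotation /= /bar conj_longestE.
  rewrite e -[c 1]/s; split=> //; first exact: conj_longest_in.
  by move=> ets; apply: st; rewrite -ets /bar -conj_longestE // conj_longestK.
have [h1 h2] : (M `\ c n.+1) (c n.+2).
  by rewrite rotationJ; apply: conj_longest_in; [exact: setD1_finitary|split].
by split=> // e; apply: h2; rewrite -e.
Qed.

Lemma add_base i : c i |` base i = M `\ c i.+1.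
Proof.
have [Mi _ neq] := rotation_in i; apply/seteqP; split=> x.
  by move=> [->|[Mx /not_orP[]]].
move=> [Mx nx]; have [->|nx'] := pselect (x = c i); first by left.
by right; split=> // -[].
Qed.

Lemma sub_base i : (M `\ c i.+1) `\ c i.+2 = base i.+1.
Proof.
apply/seteqP; split=> x.
  by move=> [[Mx h1] h2]; split=> // -[].
by move=> [Mx /not_orP[h1 h2]].
Qed.

Lemma next_base i : next (base i) (c i) = base i.+1.
Proof. by rewrite /next add_base -rotationJ sub_base. Qed.

Definition rot_seq i n := [seq c j | j <- iota i n].

Lemma rot_seqS i n : rot_seq i n.+1 = rcons (rot_seq i n) (c (i + n)).
Proof. by rewrite /rot_seq -addn1 iotaD map_cat cats1. Qed.

Lemma not_base i : ~ (base i) (c i).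
Proof. by move=> [_]; apply; right. Qed.

Lemma add_base_finitary i : finitary S (c i |` base i).
Proof. by rewrite add_base; apply: setD1_finitary. Qed.

Lemma base_finitary i : finitary S (base i).
Proof. by apply: finitary_sub fM _ => x []. Qed.

Lemma valid_rot_seq i n : valid (base i) (rot_seq i n).
Proof.
elim: n i => //= n IH i; split; [exact: not_base|exact: add_base_finitary|].
by rewrite next_base; apply: IH.
Qed.

Lemma target_rot_seq i n : target (base i) (rot_seq i n) = base (i + n).
Proof.
elim: n i => [|n IH] i; first by rewrite addn0.
by rewrite /= -/(target _ _) next_base IH addSnnS.
Qed.

Lemma braid_lhsE k :
  braid_lhs S M s t k = atomic_expr (base 0) (rot_seq 0 k.+1).
Proof.
have tail n i : addrem_tail (base i) [seq (c j, c j.+2) | j <- iota i n] =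
    atomic_tail (base i) (rot_seq i n).
  elim: n i => //= n IH i.
  by rewrite next_base -IH add_base sub_base.
by rewrite /braid_lhs /addrem (tail _ 0%N).
Qed.

Local Notation E n := (elem (base 0) (rot_seq 0 n)).

Lemma elem_rotS n : E n.+1 = E n * atom (base n) (c n).
Proof. by rewrite rot_seqS -cats1 elem_cat target_rot_seq /= mulg1. Qed.

Lemma weight_rotS n :
  weight (base 0) (rot_seq 0 n.+1) =
  (weight (base 0) (rot_seq 0 n) + len (atom (base n) (c n)))%N.
Proof. by rewrite rot_seqS -cats1 weight_cat target_rot_seq /= addn0. Qed.

Lemma atom_rot_in n : parabolic M (atom (base n) (c n)).
Proof.
apply: sub_parabolic (atom_in (add_base_finitary n)).
by rewrite add_base => x [].
Qed.

Lemma elem_rot_in n : parabolic M (E n).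
Proof.
elim: n => [|n IH]; first exact: parabolic1.
by rewrite elem_rotS; apply: parabolicM => //; apply: atom_rot_in.
Qed.

Local Notation tightE n := (tight (base 0) (rot_seq 0 n)).

(** Every atom has positive length and the product stays in the finite group W_M; hence the depth d
    exists. *)
Lemma tight_rot_bound n : tightE n -> (n <= len (w_ M))%N.
Proof.
have := weight_size (valid_rot_seq 0 n); rewrite size_map size_iota.
move=> h e; apply: leq_trans h _; rewrite -e.
by have [_] := longestP fM; apply; apply: elem_rot_in.
Qed.

Lemma tight_rot1 : tightE 1.
Proof. by rewrite /tight /= mulg1 addn0. Qed.

Lemma reduced_braid_lhs k : reduced S (braid_lhs S M s t k) <-> tightE k.+1.
Proof.
rewrite braid_lhsE; apply: reduced_atomic; last exact: valid_rot_seq.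
exact: base_finitary.
Qed.

Lemma braid_depth_exists : exists d, braid_depth S M s t d.
Proof.
have ex : exists k, `[< tightE k.+1 >].
  by exists 0%N; apply/asboolP; apply: tight_rot1.
have le k : `[< tightE k.+1 >] -> (k <= len (w_ M))%N.
  by move=> /asboolP /tight_rot_bound /ltnW.
case: (ex_maxnP ex le) => d /asboolP td dmax; exists d; split.
  exact/reduced_braid_lhs.
by move=> k /reduced_braid_lhs tk; apply: dmax; apply/asboolP.
Qed.

(* When the left-hand side cannot be prolonged, [w_K E] has the two elements of
   M outside [base d.+1] as right descents as well. *)
Lemma elem_braid_lhs d : braid_depth S M s t d -> E d.+1 = w_ (base 0) * w_ M.
Proof.
move=> [/reduced_braid_lhs td dmax].
have fb := base_finitary 0; have vl := valid_rot_seq 0 d.+1.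
have Emin := tight_rmin fb vl td; rewrite target_rot_seq in Emin.
have Elmin := tight_lmin fb vl td.
(* Otherwise one more atom could be appended, against the maximality of d. *)
have Ec1 : (len (E d.+1 * c d.+1) < len (E d.+1))%N.
  have Sc : S (c d.+1) by have [/(finitaryS fM)] := rotation_in d.+1.
  rewrite ell_lt_neg_r //; apply/negP => h.
  have add : len (E d.+1 * w_ (c d.+1 |` base d.+1)) =
      (len (E d.+1) + len (w_ (c d.+1 |` base d.+1)))%N.
    by apply: rmin_longest => [|x [->//|/Emin//]]; apply: add_base_finitary.
  have := proj2 (ell_mul_atom (@not_base _) (add_base_finitary _) Emin) add.
  rewrite td -weight_rotS -elem_rotS => /reduced_braid_lhs /dmax.
  by rewrite ltnn.
(* [c d.+2] is the element removed by the last atom, hence a right descent of that atom. *)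
have Ec2 : (len (E d.+1 * c d.+2) < len (E d.+1))%N.
  rewrite {1}elem_rotS -mulA; apply: leq_ltn_trans (ellM _ _) _.
  rewrite td weight_rotS.
  apply: leq_ltn_trans (leq_add (ell_elem_le _ _) (leqnn _)) _.
  rewrite ltn_add2l rotationJ -add_base.
  exact: atom_rdesc (@not_base _) (add_base_finitary _).
have ewE : w_ (base 0) * E d.+1 = E d.+1 * w_ (base d.+1).
  have tb : base d.+1 = conj_set (base 0) (E d.+1).
    by rewrite conj_set_elem // target_rot_seq.
  rewrite tb longest_conj // -?tb; first by rewrite conjgE mulVKg.
  exact: finitaryS (base_finitary _).
suff <- : w_ (base 0) * E d.+1 = w_ M by rewrite longest_mulK.
apply: rmax_longest => //.
  apply: parabolicM; last exact: elem_rot_in.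
  by apply: sub_parabolic (longest_in fb) => x [].
have desc x : (len (E d.+1 * x) < len (E d.+1))%N ->
    (len (w_ (base 0) * E d.+1 * x) < len (w_ (base 0) * E d.+1))%N.
  move=> h; rewrite lmin_longest // -mulA.
  by apply: leq_ltn_trans (ellM _ _) _; rewrite ltn_add2l.
move=> x Mx; have [->|n1] := pselect (x = c d.+1); first exact: desc.
have [->|n2] := pselect (x = c d.+2); first exact: desc.
rewrite ewE; apply: rmin_longest_rmax Emin _ _; first exact: base_finitary.
by split=> // -[].
Qed.

(** * The right-hand side of a braid relation *)

Local Notation b i := (c i ^ w_ M).
Local Notation cobase i := (M `\` [set b i.+1; b i]).

Lemma barE x : bar S M x = x ^ w_ M.
Proof. by rewrite /bar conj_longestE. Qed.

Lemma conj_setD A : conj_set (M `\` A) (w_ M) = M `\` conj_set A (w_ M).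
Proof.
apply/seteqP; split=> [_ [x [Mx nAx] <-]|x [Mx nAx]].
  split; first exact: conj_longest_in.
  by move=> [y Ay /conjg_inj exy]; apply: nAx; rewrite -exy.
exists (x ^ w_ M); rewrite ?conj_longestK //; split.
  exact: conj_longest_in.
by move=> Ax; apply: nAx; exists (x ^ w_ M); rewrite ?conj_longestK.
Qed.

Lemma conj_set1 x z : conj_set [set x] z = [set x ^ z].
Proof. exact: image_set1. Qed.

Lemma cobaseE i : cobase i = conj_set (base i) (w_ M).
Proof. by rewrite conj_setD /conj_set image_setU !image_set1. Qed.

Lemma cobase_finitary i : finitary S (cobase i).
Proof. by apply: finitary_sub fM _ => x []. Qed.

Lemma longest_cobase i : w_ (cobase i) = w_ (base i) ^ w_ M.
Proof.
rewrite cobaseE longest_conj //; first exact: base_finitary.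
by rewrite -cobaseE; apply: finitaryS (cobase_finitary _).
Qed.

Lemma longest_setD1J x : w_ (M `\ (x ^ w_ M)) = w_ (M `\ x) ^ w_ M.
Proof.
rewrite -conj_set1 -conj_setD longest_conj //; first exact: setD1_finitary.
by rewrite conj_setD conj_set1; apply: finitaryS (setD1_finitary _).
Qed.

Lemma corotationJ i : b i = b i.+2 ^ w_ (M `\ b i.+1).
Proof.
rewrite longest_setD1J -conjJg rotationJ; congr (_ ^ _).
by rewrite conj_longestK //; apply: setD1_finitary.
Qed.

Lemma add_cobase i : b i.+2 |` cobase i.+1 = M `\ b i.+1.
Proof.
have [_ Mi neq] := rotation_in i.+1; apply/seteqP; split=> x.
  move=> [->|[Mx /not_orP[]]] //; split; first exact: conj_longest_in.
  by move=> /conjg_inj e; apply: neq; rewrite e.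
move=> [Mx nx]; have [->|nx'] := pselect (x = b i.+2); first by left.
by right; split=> // -[].
Qed.

Lemma sub_cobase i : (M `\ b i.+1) `\ b i = cobase i.
Proof.
apply/seteqP; split=> x.
  by move=> [[Mx h1] h2]; split=> // -[].
by move=> [Mx /not_orP[h1 h2]].
Qed.

Lemma next_cobase i : next (cobase i.+1) (b i.+2) = cobase i.
Proof. by rewrite /next add_cobase -corotationJ sub_cobase. Qed.

Definition corot_seq n := [seq b i.+2 | i <- rev (iota 0 n)].

Lemma corot_seqS n : corot_seq n.+1 = b n.+2 :: corot_seq n.
Proof. by rewrite /corot_seq -[in iota _ _]addn1 iotaD rev_cat. Qed.

Lemma valid_corot_seq n : valid (cobase n) (corot_seq n).
Proof.
elim: n => // n IH; rewrite corot_seqS /=; split.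
- by move=> [_]; apply; left.
- by rewrite add_cobase; apply: setD1_finitary.
- by rewrite next_cobase.
Qed.

Lemma target_corot_seq n : target (cobase n) (corot_seq n) = cobase 0.
Proof.
by elim: n => // n IH; rewrite corot_seqS /= -/(target _ _) next_cobase.
Qed.

Lemma braid_rhsE k : base 0 = cobase k.+1 ->
  braid_rhs S M s t k = atomic_expr (base 0) (corot_seq k.+1).
Proof.
move=> e; rewrite /braid_rhs /addrem -[braid_base S M s t]/(base 0) e.
rewrite /atomic_expr; congr (_ :: _); elim: (k.+1) => [//|n IH].
rewrite -[in iota _ _]addn1 iotaD rev_cat corot_seqS /= next_cobase -IH !barE.
by rewrite add_cobase sub_cobase.
Qed.

(** The right-hand side is the left-hand side read backwards and conjugated by w_M; reading an atom
    w_P w_L backwards gives its inverse w_L w_P. *)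
Lemma atom_cobase i :
  atom (cobase i.+1) (b i.+2) = (atom (base i) (c i))^-1 ^ w_ M.
Proof.
have fb := add_base_finitary i.
rewrite (atomE (@not_base i) fb) next_base /atom add_cobase add_base.
rewrite longest_cobase longest_setD1J invgM !longestV ?conjMg //.
  exact: setD1_finitary.
exact: base_finitary.
Qed.

Lemma elem_corot_seq n : elem (cobase n) (corot_seq n) = (E n)^-1 ^ w_ M.
Proof.
elim: n => [|n IH]; first by rewrite /= invg1 conj1g.
by rewrite elem_rotS invgM conjMg corot_seqS /= next_cobase IH atom_cobase.
Qed.

Lemma weight_corot_seq n :
  weight (cobase n) (corot_seq n) = weight (base 0) (rot_seq 0 n).
Proof.
elim: n => // n IH.
rewrite weight_rotS corot_seqS /= next_cobase IH atom_cobase addnC.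
by rewrite ell_conj_longest // ?ellV //; apply: parabolicV; apply: atom_rot_in.
Qed.

Lemma tight_corot_seq n : tightE n -> tight (cobase n) (corot_seq n).
Proof.
rewrite /tight elem_corot_seq weight_corot_seq => <-.
by rewrite ell_conj_longest ?ellV //; apply: parabolicV; apply: elem_rot_in.
Qed.

Section Depth.

Variable d : nat.
Hypothesis depth : braid_depth S M s t d.

Lemma conj_set_longestM I z : finitary S I ->
  conj_set I (w_ I * z) = conj_set I z.
Proof. by move=> fI; rewrite -conj_setM conj_set_longest. Qed.

(** The left-hand product w_K w_M conjugates K to its target, and w_K preserves K. *)
Lemma base_depth : base d.+1 = cobase 0.
Proof.
have := conj_set_elem (valid_rot_seq 0 d.+1).
rewrite elem_braid_lhs // conj_set_longestM; last exact: base_finitary.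
by rewrite cobaseE target_rot_seq => ->.
Qed.

Lemma cobase_depth : cobase d.+1 = base 0.
Proof.
rewrite cobaseE base_depth cobaseE conj_setM longest2 // -{1}(mulgV 1).
by rewrite -conj_setM conj_setK.
Qed.

(* Otherwise both sides of the relation agree, i.e. ubar_{d-i} = u_i for all i.
   With F the product of the first half of the atoms, w_K w_M is then
   F (F^-1)^{w_M} or F a_m (F^-1)^{w_M}, which
   gives w_{K_m} = w_M, resp. w_{M - u_m} = w_M. *)
Lemma corotation_depth_neq : b d.+2 <> c 0.
Proof.
move=> e0; have e1 : b d.+1 = c 1.
  have : ~ base 0 (b d.+1) by rewrite -cobase_depth => -[_]; apply; right.
  have [Md _ neq] := rotation_in d.+1.
  move=> nb; have [//|n1] := pselect (b d.+1 = c 1).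
  case: nb; split; first exact: conj_longest_in.
  by case=> // e; apply: neq; apply: (@conjg_inj _ (w_ M)); rewrite e e0.
(* The sequence c run forwards and b run backwards obey the same two-term recursion and now share
   their initial values. *)
have pal i : (i <= d.+1)%N -> b (d.+2 - i) = c i /\ b (d.+1 - i) = c i.+1.
  elim: i => [_|i IH lti]; first by rewrite !subn0.
  have [h1 h2] := IH (ltnW lti); rewrite subSS; split=> //.
  rewrite corotationJ [RHS]rotationJ -h1 -h2.
  have -> : ((d.+1 - i.+1).+1 = d.+1 - i)%N by lia.
  by have -> : ((d.+1 - i).+1 = d.+2 - i)%N by lia.
have seqE m : (m <= d.+1)%N -> rot_seq (d.+1 - m) m = corot_seq m.
  elim: m => // m IH ltm; rewrite corot_seqS -IH ?(ltnW ltm) //.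
  rewrite /rot_seq /=; congr (_ :: _).
    have [|<- _] := pal (d.+1 - m.+1)%N; first by lia.
    by have -> : (d.+2 - (d.+1 - m.+1) = m.+2)%N by lia.
  by have -> : ((d.+1 - m.+1).+1 = d.+1 - m)%N by lia.
have cobE m : (m <= d.+1)%N -> base (d.+1 - m) = cobase m.
  move=> lem; have [|h1 h2] := pal (d.+1 - m)%N; first by lia.
  rewrite -h1 -h2 setUC.
  have -> : (d.+1 - (d.+1 - m) = m)%N by lia.
  by have -> : (d.+2 - (d.+1 - m) = m.+1)%N by lia.
have half m : (m <= d.+1)%N -> E (d.+1 - m) * w_ M * (E m)^-1 = w_ (base 0).
  move=> lem; have : E d.+1 = E (d.+1 - m) * (E m)^-1 ^ w_ M.
    rewrite -elem_corot_seq -cobE // -seqE //.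
    rewrite -{1}(subnK lem) /rot_seq iotaD map_cat elem_cat add0n.
    by rewrite -/(rot_seq 0 _) target_rot_seq.
  rewrite elem_braid_lhs // conj_longestE // => e.
  by rewrite -[RHS](mul_longestK fM) e !mulA mul_longestK.
have sub_neq x A : A `<=` M -> M x -> ~ A x -> w_ A <> w_ M.
  by move=> AM Mx nAx /(longest_sub_inj fM AM) /(_ x Mx).
have conjE m : (w_ (base 0)) ^ E m = w_ (base m).
  have tb : base m = conj_set (base 0) (E m).
    by rewrite conj_set_elem ?target_rot_seq //; apply: valid_rot_seq.
  rewrite tb longest_conj // -?tb; first exact: base_finitary.
  exact: finitaryS (base_finitary _).
(* Cut the palindrome of d+1 atoms in the middle; for odd d+1 one atom is left over there. *)
have := odd_double_half d.+1; rewrite -addnn; set m := (d.+1)./2.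
case: (odd _) => /= em; have lem : (m <= d.+1)%N by lia.
  have := half _ lem; have -> : (d.+1 - m = m.+1)%N by lia.
  move=> e; have := conjE m; rewrite -e elem_rotS conjgE.
  rewrite !mulA mulVg mul1g mulgVK /atom add_base -mulA -[RHS]mulg1.
  move=> /mulgI h; have [_ Mm1 _] := rotation_in m.
  apply: (sub_neq (c m.+1) (M `\ c m.+1)) => //.
  - by move=> [_]; apply.
  by rewrite -[LHS](mul_longestK fM) h mul1g.
have := half _ lem; have -> : (d.+1 - m = m)%N by lia.
move=> e; have := conjE m; rewrite -e conjgE !mulA mulVg mul1g mulgVK => /esym.
have [Mm _ _] := rotation_in m.
by apply: (sub_neq (c m)) => //; apply: not_base.
Qed.

(** The element that the right-hand side adds first lies in M but not in K, so it is u_{-1} or u_0;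
    the former is excluded. Hence the two sides start with different atoms. *)
Lemma corotation_depth : b d.+2 = c 1.
Proof.
have : ~ base 0 (b d.+2) by rewrite -cobase_depth => -[_]; apply; left.
move=> nb; have [//|n1] := pselect (b d.+2 = c 1); case: nb.
have [_ Md _] := rotation_in d.+1; split; first exact: conj_longest_in.
by case=> //; apply: corotation_depth_neq.
Qed.

Lemma elem_braid_rhs : elem (base 0) (corot_seq d.+1) = w_ (base 0) * w_ M.
Proof.
rewrite -cobase_depth elem_corot_seq elem_braid_lhs // cobase_depth.
rewrite invgM !longestV //; last exact: base_finitary.
by rewrite conj_longestE // longest_mulK.
Qed.

End Depth.

End Rotation.

(** * The induction *)

Lemma braid_step_related Ks Ks' : braid_step S Ks Ks' -> braid_related S Ks Ks'.
Proof. by move=> h; apply: Relation_Operators.rt_step. Qed.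

Lemma braid_related_cat Ks0 Ks Ks' :
  braid_related S Ks Ks' -> braid_related S (Ks0 ++ Ks) (Ks0 ++ Ks').
Proof.
elim=> [x y [a [b [l [r [lr -> ->]]]]]|x|x y z _ h1 _ h2].
- apply: braid_step_related; exists (Ks0 ++ a), b, l, r.
  by split; rewrite // !catA.
- exact: Relation_Operators.rt_refl.
- exact: Relation_Operators.rt_trans h1 h2.
Qed.

Lemma exists_braid I a a' : ~ I a -> ~ I a' -> a <> a' ->
  finitary S (a |` (a' |` I)) ->
  exists l l', let M := a |` (a' |` I) in
    [/\ valid I (a :: l), valid I (a' :: l'),
        target I (a :: l) = target I (a' :: l')
      & [/\ tight I (a :: l) /\ tight I (a' :: l'),
        elem I (a :: l) = w_ I * w_ M, elem I (a' :: l') = w_ I * w_ M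
      & atomic_braid S (atomic_expr I (a :: l)) (atomic_expr I (a' :: l'))]].
Proof.
set M := a |` _ => nIa nIa' neq fM.
have Ma : M a by left.
have Ma' : M a' by right; left.
(* For the triple (M, a', t) with t the conjugate of a by w_M, the rotation sequence has u_{-1} = a
   and u_0 = a', and its base is I. *)
have Mt : M (a ^ w_ M) by apply: conj_longest_in.
have st : a ^ w_ M <> bar S M a' by rewrite barE // => /conjg_inj.
have [d depth] := braid_depth_exists fM Ma' Mt st.
have c0 : rotation S M a' (a ^ w_ M) 0 = a.
  by rewrite /rotation /= barE // conj_longestK.
have b0 : M `\` [set rotation S M a' (a ^ w_ M) 1;
                    rotation S M a' (a ^ w_ M) 0] = I.
  rewrite c0 -[rotation _ _ _ _ 1]/a'; apply/seteqP; split=> x.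
    by move=> [[->|[->|//]] n]; case: n; [right|left].
  move=> Ix; split; first by right; right.
  by case=> e; [apply: nIa'|apply: nIa]; rewrite -e.
have cb := cobase_depth fM Ma' Mt st depth.
have c1 := corotation_depth fM Ma' Mt st depth.
have vl := valid_rot_seq fM Ma' Mt st 0 d.+1.
have vr := valid_corot_seq fM Ma' Mt st d.+1.
have tr := target_corot_seq fM Ma' Mt st d.+1.
have tl := target_rot_seq fM Ma' Mt st 0 d.+1.
have td := base_depth fM Ma' Mt st depth.
have kl := proj1 (reduced_braid_lhs fM Ma' Mt st d) (proj1 depth).
have kr := tight_corot_seq fM Ma' Mt st kl.
have el := elem_braid_lhs fM Ma' Mt st depth.
have er := elem_braid_rhs fM Ma' Mt st depth.
have ll := braid_lhsE fM Ma' Mt st d.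
have rr := braid_rhsE fM Ma' Mt st (esym cb).
rewrite add0n td -tr in tl; rewrite cb in vr tr tl kr.
rewrite b0 in vl vr tl kl kr el er ll rr.
move: vr tl kr er rr; rewrite corot_seqS c1 -[rotation _ _ _ _ 1]/a'.
move: vl kl el ll; rewrite /rot_seq /= c0 => *.
do 2!eexists; split; [eassumption|eassumption|eassumption|].
split; [by split; eassumption|eassumption|eassumption|].
by exists M, a', (a ^ w_ M), d; split; last exact: esym.
Qed.

Lemma tight_related I l l' : finitary S I -> valid I l -> valid I l' ->
  tight I l -> tight I l' -> elem I l = elem I l' ->
  braid_related S (atomic_expr I l) (atomic_expr I l').
Proof.
have [n] := ubnP (len (elem I l)); elim: n I l l' => // n IH I l l' len_l fI.
(* A common first atom cancels; it has positive length, so the induction hypothesis covers the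
   tails. *)
have same a m m' : (len (elem I (a :: m)) < n.+1)%N -> valid I (a :: m) ->
    valid I (a :: m') -> tight I (a :: m) -> tight I (a :: m') ->
    elem I (a :: m) = elem I (a :: m') ->
    braid_related S (atomic_expr I (a :: m)) (atomic_expr I (a :: m')).
  move=> lt [nIa fP vm] [_ _ vm'] tm tm' /mulgI e.
  apply: (@braid_related_cat [:: I; a |` I]).
  have [_ tm1] := @tight_cat I [:: a] m tm.
  have [_ tm1'] := @tight_cat I [:: a] m' tm'.
  apply: IH => //; last exact: next_finitary.
  move: tm lt tm1; rewrite /tight /= => -> + ->.
  by have := atom_gt0 nIa fP; lia.
case: l len_l => [|a l] len_l vl vl' tl tl' e.
  suff -> : l' = [::] by apply: Relation_Operators.rt_refl.
  apply/nilP; rewrite /nilp -leqn0; apply: leq_trans (weight_size vl') _.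
  by rewrite -tl' -e ell1.
case: l' vl' tl' e => [|a' l'] vl' tl' e.
  have := weight_size vl; rewrite -tl e ell1 //.
have [eaa'|naa'] := pselect (a = a').
  by subst a'; apply: same.
set x := elem I (a :: l) in len_l e.
have desc b m : valid I (b :: m) -> tight I (b :: m) -> elem I (b :: m) = x ->
    (len (b * x) < len x)%N.
  move=> [nIb fP _] tm <-; rewrite tm /= mulA.
  apply: leq_ltn_trans (ellM _ _) _; have := atom_ldesc nIb fP.
  by have := ell_elem_le (next I b) m; lia.
have [nIa fIa _] := vl; have [nIa' fIa' _] := vl'.
set M := a |` (a' |` I).
have IM : I `<=` M by move=> s; right; right.
have MS : M `<=` S.
  move=> s [->|[->|Is]]; last exact: (finitaryS fI).
    by apply: (finitaryS fIa); left.
  by apply: (finitaryS fIa'); left.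
have finM : finite_set M.
  rewrite !finite_setU; split; first exact: finite_set1.
  by split; [exact: finite_set1|exact: finitary_finite].
have xI := tight_lmin fI vl tl.
have xIS : conj_set I x `<=` S.
  rewrite conj_set_elem //; exact: finitaryS (target_finitary fI vl).
have [|y [fM yM xy lxy]] := core_factor fI IM MS finM xI xIS.
  by move=> s [->|[->|//]] _; [apply: desc vl tl _|apply: desc vl' tl' _].
have [m [m' [vm vm' etm [[tm tm'] em em' br]]]] :=
  exists_braid nIa nIa' naa' fM.
have fT := target_finitary fI vm.
have conjT : conj_set I (w_ I * w_ M) = target I (a :: m).
  by rewrite -em conj_set_elem.
(* Both sides of the braid relation end at the same subset, so one expression r of y continues them
   both. *)
have [||r [vr tr er]] := @exists_tight (target I (a :: m)) y fT.
- move=> s; rewrite -conjT -conj_setM (conj_set_longest fI) => -[z Iz <-].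
  exact/yM/(conj_longest_in fM)/IM.
- by rewrite -conjT conj_setM -xy.
have vmr : valid I ((a :: m) ++ r) by apply/valid_cat.
have vmr' : valid I ((a' :: m') ++ r) by apply/valid_cat; rewrite -etm.
have emr : elem I ((a :: m) ++ r) = x by rewrite elem_cat er em -xy.
have emr' : elem I ((a' :: m') ++ r) = x by rewrite elem_cat -etm er em' -xy.
have tmr : tight I ((a :: m) ++ r).
  by rewrite /tight emr weight_cat -tm -tr em er.
have tmr' : tight I ((a' :: m') ++ r).
  by rewrite /tight emr' weight_cat -tm' -etm -tr em' er.
apply: (@Relation_Operators.rt_trans _ _ _ (atomic_expr I ((a :: m) ++ r))).
  by apply: same.
apply: (@Relation_Operators.rt_trans _ _ _ (atomic_expr I ((a' :: m') ++ r))).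
  apply: braid_step_related.
  exists [::], (atomic_tail (target I (a :: m)) r),
    (atomic_expr I (a :: m)), (atomic_expr I (a' :: m')).
  split; first by left.
    by rewrite /atomic_expr atomic_tail_cat.
  by rewrite /atomic_expr atomic_tail_cat -etm.
by apply: same; rewrite ?emr'.
Qed.

(** The product of the atoms is recovered from the coset and J alone, so two expressions of p have
    equal products. *)
Lemma atomic_reduced_tight I J p e : finitary S I -> expresses S e I J p ->
  atomic S e -> reduced S e ->
  exists l, [/\ valid I l, tight I l, e = atomic_expr I l
    & elem I l = top S p * w_ J].
Proof.
case: e => [|I0 Ks] fI [eKs eI eJ ep]; first by case: eKs.
move=> [_ at_e] red.
rewrite /= in eI; subst I0.
have [l vl el] := atomic_from_valid fI at_e; subst Ks.
have tl := proj1 (reduced_atomic fI vl) red; exists l; split=> //.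
have [_] := expressed_atomic fI vl tl; rewrite ep => ->.
move: eJ (target_finitary fI vl); rewrite /= last_atomic_tail => -> fJ.
by rewrite mul_longestK.
Qed.

End Coxeter.

Theorem theorem1p8 (W : groupType) (S : set W) (hS : coxeter_system S)
    (I J : set W) (hI : finitary S I) (hJ : finitary S J)
    (p : set W) (hp : core S I J p)
    (e e' : seq (set W))
    (he : expresses S e I J p) (hea : atomic S e) (her : reduced S e)
    (he' : expresses S e' I J p) (hea' : atomic S e') (her' : reduced S e') :
  braid_related S e e'.
Proof.
have [l [vl tl -> el]] := atomic_reduced_tight hS hI he hea her.
have [l' [vl' tl' -> el']] := atomic_reduced_tight hS hI he' hea' her'.
by apply: tight_related => //; rewrite el.
Qed.
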